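(* Let $\mathcal C$ be a (strict) braided monoidal category in which idempotents split. Trivalent Hopf data $(B_1,B_2,\mu_l,\nu_l,\mu_r,\nu_r)$ in $\mathcal C$ of the following five types, and their bialgebras $B=B_1\otimes B_2$, are equivalently described as follows. (i) $\mu_l,\mu_r,\nu_l,\nu_r$ all trivial. The Hopf datum is equivalently given by: $B_1$ and $B_2$ are bialgebras in $\mathcal C$ and $\Psi_{B_2,B_1}\circ\Psi_{B_1,B_2}=\mathrm{id}_{B_1\otimes B_2}$. The bialgebra $B$ is the canonical tensor product bialgebra $B_1\otimes B_2$. (ii) $\mu_r,\nu_r$ trivial. The Hopf datum is equivalently given by: $B_2$ is a bialgebra in $\mathcal C$ and $(B_1,\mu_l,\nu_l)$ is a bialgebra in the category of left $B_2$-crossed modules. The bialgebra $B$ is the (braided) biproduct: $\mathrm m_B,\Delta_B$ are given with $\phi_{2,1}=(\mu_l\otimes\mathrm{id}_2)(\mathrm{id}_2\otimes\Psi_{2,1})(\Delta_2\otimes\mathrm{id}_1)$ and $\phi_{1,2}=(\mathrm m_2\otimes\mathrm{id}_1)(\mathrm{id}_2\otimes\Psi_{1,2})(\nu_l\otimes\mathrm{id}_2)$. (iii) $\nu_l,\nu_r$ trivial. The Hopf datum is equivalently given by a braided matched pair $(B_1,B_2,\mu_l,\mu_r)$: $B_1,B_2$ are bialgebras in $\mathcal C$, $B_1$ is a left $B_2$-module coalgebra via $\mu_l$, $B_2$ is a right $B_1$-module coalgebra via $\mu_r$, and $$\mu_r(\mathrm m_2\otimes\mathrm{id}_1)=\mathrm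 m_2(\mu_r\otimes\mathrm{id}_2)(\mathrm{id}_2\otimes\phi_{2,1}),\quad\mu_r(\eta_2\otimes\mathrm{id}_1)=\eta_2\varepsilon_1,$$ $$\mu_l(\mathrm{id}_2\otimes\mathrm m_1)=\mathrm m_1(\mathrm{id}_1\otimes\mu_l)(\phi_{2,1}\otimes\mathrm{id}_1),\quad\mu_l(\mathrm{id}_2\otimes\eta_1)=\eta_1\varepsilon_2,$$ $$(\mu_r\otimes\mu_l)(\mathrm{id}_2\otimes\Psi_{2,1}\otimes\mathrm{id}_1)(\Delta_2\otimes\Delta_1)=\Psi_{1,2}\circ\phi_{2,1},$$ where $\phi_{2,1}=(\mu_l\otimes\mu_r)(\mathrm{id}_2\otimes\Psi_{2,1}\otimes\mathrm{id}_1)(\Delta_2\otimes\Delta_1)$. The bialgebra $B$ (braided double cross product) has $\mathrm m_B=(\mathrm m_1\otimes\mathrm m_2)(\mathrm{id}_1\otimes\phi_{2,1}\otimes\mathrm{id}_2)$ and $\Delta_B=(\mathrm{id}_1\otimes\Psi_{1,2}\otimes\mathrm{id}_2)(\Delta_1\otimes\Delta_2)$. (iv) $\mu_l,\nu_r$ trivial. The Hopf datum is equivalently given by: $B_1,B_2$ are bialgebras in $\mathcal C$, $B_1$ is a left $B_2$-comodule coalgebra via $\nu_l$, $B_2$ is a right $B_1$-module algebra via $\mu_r$, and $$\varepsilon_2\circ\mu_r=\varepsilon_2\otimes\varepsilon_1,\quad\nu_l\circ\eta_1=\eta_2\otimes\eta_1,$$ $$(\mathrm m_2\otimes\mathrm{id}_1)(\mathrm{id}_2\otimes\Psi_{1,2})(\nu_l\otimes\mu_r)(\Psi_{2,1}\otimes\mathrm{id}_1)(\mathrm{id}_2\otimes\Delta_1)=(\mathrm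 m_2\otimes\mathrm{id}_1)(\mu_r\otimes\nu_l)(\mathrm{id}_2\otimes\Delta_1),$$ $$\Delta_2\mu_r=(\mathrm m_2\otimes\mu_r)(\mu_r\otimes\Psi_{2,2}\otimes\mathrm{id}_1)(\mathrm{id}_2\otimes\Psi_{2,1}\otimes\nu_l)(\Delta_2\otimes\Delta_1),$$ $$\nu_l\mathrm m_1=(\mathrm m_2\otimes\mathrm m_1)(\mu_r\otimes\Psi_{1,2}\otimes\mathrm{id}_1)(\mathrm{id}_2\otimes\Psi_{1,1}\otimes\nu_l)(\nu_l\otimes\Delta_1).$$ The bialgebra $B$ (braided bicross product) has $\mathrm m_B=(\mathrm m_1\otimes\mathrm m_2)\big(\mathrm{id}_1\otimes(\mathrm{id}_1\otimes\mu_r)(\Psi_{2,1}\otimes\mathrm{id}_1)(\mathrm{id}_2\otimes\Delta_1)\otimes\mathrm{id}_2\big)$ and $\Delta_B=\big(\mathrm{id}_1\otimes(\mathrm m_2\otimes\mathrm{id}_1)(\mathrm{id}_2\otimes\Psi_{1,2})(\nu_l\otimes\mathrm{id}_2)\otimes\mathrm{id}_2\big)(\Delta_1\otimes\Delta_2)$. (v) $\mu_l$ trivial (the most general trivalent type). The Hopf datum is equivalently given by: $B_1$ is a bialgebra in $\mathcal C$ and a left $B_2$-comodule via $\nu_l$; $B_2$ is an algebra with $\varepsilon_2$ an algebra morphism, is a right $B_1$-module algebra via $\mu_r$ and a right $B_1$-comodule algebra via $\nu_r$, and is a coalgebra with $\eta_2$ a coalgebra morphism; and $$\varepsilon_2\mu_r=\varepsilon_2\otimes\varepsilon_1,\quad\nu_l\eta_1=\eta_2\otimes\eta_1,\quad(\varepsilon_2\otimes\mathrm{id}_1)\nu_r=\eta_1\varepsilon_2,\quad(\mathrm{id}_2\otimes\varepsilon_1)\nu_l=\eta_2\varepsilon_1,$$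 $$\Delta_2\mathrm m_2=(\mathrm m_2\otimes\mathrm m_2)(\mathrm{id}_2\otimes\mathrm{id}_2\otimes\mu_r\otimes\mathrm{id}_2)(\mathrm{id}_2\otimes\Psi_{2,2}\otimes\mathrm{id}_1\otimes\mathrm{id}_2)(\mathrm{id}_2\otimes\mathrm{id}_2\otimes\nu_r\otimes\mathrm{id}_2)(\Delta_2\otimes\Delta_2),$$ $$\phi_{1,2}(\mathrm{id}_1\otimes\mu_r)(\Psi_{2,1}\otimes\mathrm{id}_1)(\mathrm{id}_2\otimes\Delta_1)=(\mathrm m_2\otimes\mathrm m_1)(\mu_r\otimes\Psi_{1,2}\otimes\mathrm{id}_1)(\mathrm{id}_2\otimes\Psi_{1,1}\otimes\nu_l)(\nu_r\otimes\Delta_1),$$ $$(\Delta_2\otimes\mathrm{id}_1)\nu_r=(\mathrm{id}_2\otimes\phi_{1,2})(\nu_r\otimes\mathrm{id}_2)\Delta_2,\quad(\mathrm{id}_2\otimes\Delta_1)\nu_l=(\phi_{1,2}\otimes\mathrm{id}_1)(\mathrm{id}_1\otimes\nu_l)\Delta_1,$$ $$\Delta_2\mu_r=(\mathrm m_2\otimes\mu_r)(\mu_r\otimes\Psi_{2,2}\otimes\mathrm{id}_1)(\mathrm{id}_2\otimes\Psi_{2,1}\otimes\nu_l)(\Delta_2\otimes\Delta_1),$$ $$\nu_l\mathrm m_1=(\mathrm m_2\otimes\mathrm m_1)(\mu_r\otimes\Psi_{1,2}\otimes\mathrm{id}_1)(\mathrm{id}_2\otimes\Psi_{1,1}\otimes\nu_l)(\nu_l\otimes\Delta_1),$$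 where $\phi_{1,2}=(\mathrm m_2\otimes\mathrm m_1)(\mathrm{id}_2\otimes\Psi_{1,2}\otimes\mathrm{id}_1)(\nu_l\otimes\nu_r)$. The bialgebra $B$ has $\mathrm m_B=(\mathrm m_1\otimes\mathrm m_2)\big(\mathrm{id}_1\otimes(\mathrm{id}_1\otimes\mu_r)(\Psi_{2,1}\otimes\mathrm{id}_1)(\mathrm{id}_2\otimes\Delta_1)\otimes\mathrm{id}_2\big)$ and $\Delta_B=(\mathrm{id}_1\otimes\phi_{1,2}\otimes\mathrm{id}_2)(\Delta_1\otimes\Delta_2)$.
   Context: $\mathcal C$ has tensor product $\otimes$, unit object $I$, braiding $\Psi$. Algebras are unital associative, coalgebras counital coassociative, bialgebras are in the braided sense: $\Delta\circ\mathrm m=(\mathrm m\otimes\mathrm m)\circ(\mathrm{id}\otimes\Psi\otimes\mathrm{id})\circ(\Delta\otimes\Delta)$, with $\varepsilon$ an algebra morphism and $\eta$ a coalgebra morphism. Write $\mathrm{id}_j=\mathrm{id}_{B_j}$, $\Psi_{i,j}=\Psi_{B_i,B_j}$; juxtaposition denotes composition. (Co)module (co)algebras are taken with respect to diagonal (co)actions on tensor products formed with $\Psi$. Hopf datum. A Hopf datum $(B_1,B_2,\mu_l,\nu_l,\mu_r,\nu_r)$ consists of objects $B_1,B_2$, each an algebra $(\mathrm m_j,\eta_j)$ and a coalgebra $(\Delta_j,\varepsilon_j)$ such that $\varepsilon_j$ is an algebra morphism and $\eta_j$ is a coalgebra morphism; a left $B_2$-module structure $\mu_l:B_2\otimes B_1\to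 B_1$ and a left $B_2$-comodule structure $\nu_l:B_1\to B_2\otimes B_1$ on $B_1$; a right $B_1$-module structure $\mu_r:B_2\otimes B_1\to B_2$ and a right $B_1$-comodule structure $\nu_r:B_2\to B_2\otimes B_1$ on $B_2$. Put $\phi_{1,2}=(\mathrm m_2\otimes\mathrm m_1)(\mathrm{id}_2\otimes\Psi_{1,2}\otimes\mathrm{id}_1)(\nu_l\otimes\nu_r)$ and $\phi_{2,1}=(\mu_l\otimes\mu_r)(\mathrm{id}_2\otimes\Psi_{2,1}\otimes\mathrm{id}_1)(\Delta_2\otimes\Delta_1)$. Required identities: - $\mu_r(\eta_2\otimes\mathrm{id}_1)=\eta_2\varepsilon_1=(\mathrm{id}_2\otimes\varepsilon_1)\nu_l$; $\varepsilon_2\mu_r=\varepsilon_2\otimes\varepsilon_1=\varepsilon_1\mu_l$; $\mu_l(\mathrm{id}_2\otimes\eta_1)=\eta_1\varepsilon_2=(\varepsilon_2\otimes\mathrm{id}_1)\nu_r$; $\nu_r\eta_2=\eta_2\otimes\eta_1=\nu_l\eta_1$. - Algebra-coalgebra: $\Delta_1\mathrm m_1=(\mathrm m_1\otimes\mathrm m_1)(\mathrm{id}_1\otimes\mu_l\otimes\mathrm{id}_1\otimes\mathrm{id}_1)(\mathrm{id}_1\otimes\mathrm{id}_2\otimes\Psi_{1,1}\otimes\mathrm{id}_1)(\mathrm{id}_1\otimes\nu_l\otimes\mathrm{id}_1\otimes\mathrm{id}_1)(\Delta_1\otimes\Delta_1)$ and $\Delta_2\mathrm m_2=(\mathrm m_2\otimes\mathrm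 m_2)(\mathrm{id}_2\otimes\mathrm{id}_2\otimes\mu_r\otimes\mathrm{id}_2)(\mathrm{id}_2\otimes\Psi_{2,2}\otimes\mathrm{id}_1\otimes\mathrm{id}_2)(\mathrm{id}_2\otimes\mathrm{id}_2\otimes\nu_r\otimes\mathrm{id}_2)(\Delta_2\otimes\Delta_2)$. - Module-comodule: $\phi_{1,2}\phi_{2,1}=(\mathrm m_2\otimes\mathrm m_1)(\mu_r\otimes\Psi_{1,2}\otimes\mu_l)(\mathrm{id}_2\otimes\Psi_{1,1}\otimes\Psi_{2,2}\otimes\mathrm{id}_1)(\nu_r\otimes\Psi_{2,1}\otimes\nu_l)(\Delta_2\otimes\Delta_1)$. - Module-algebra: $\mu_r(\mathrm m_2\otimes\mathrm{id}_1)=\mathrm m_2(\mu_r\otimes\mathrm{id}_2)(\mathrm{id}_2\otimes\phi_{2,1})$; $\mu_l(\mathrm{id}_2\otimes\mathrm m_1)=\mathrm m_1(\mathrm{id}_1\otimes\mu_l)(\phi_{2,1}\otimes\mathrm{id}_1)$. - Comodule-coalgebra: $(\Delta_2\otimes\mathrm{id}_1)\nu_r=(\mathrm{id}_2\otimes\phi_{1,2})(\nu_r\otimes\mathrm{id}_2)\Delta_2$; $(\mathrm{id}_2\otimes\Delta_1)\nu_l=(\phi_{1,2}\otimes\mathrm{id}_1)(\mathrm{id}_1\otimes\nu_l)\Delta_1$. - Module-coalgebra: $\Delta_2\mu_r=(\mathrm m_2\otimes\mu_r)(\mu_r\otimes\Psi_{2,2}\otimes\mathrm{id}_1)(\mathrm{id}_2\otimes\Psi_{2,1}\otimes\nu_l)(\Delta_2\otimes\Delta_1)$;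 $\Delta_1\mu_l=(\mu_l\otimes\mathrm m_1)(\mathrm{id}_2\otimes\Psi_{1,1}\otimes\mu_l)(\nu_r\otimes\Psi_{2,1}\otimes\mathrm{id}_1)(\Delta_2\otimes\Delta_1)$. - Comodule-algebra: $\nu_r\mathrm m_2=(\mathrm m_2\otimes\mathrm m_1)(\mathrm{id}_2\otimes\Psi_{1,2}\otimes\mu_l)(\nu_r\otimes\Psi_{2,2}\otimes\mathrm{id}_1)(\Delta_2\otimes\nu_r)$; $\nu_l\mathrm m_1=(\mathrm m_2\otimes\mathrm m_1)(\mu_r\otimes\Psi_{1,2}\otimes\mathrm{id}_1)(\mathrm{id}_2\otimes\Psi_{1,1}\otimes\nu_l)(\nu_l\otimes\Delta_1)$. Trivial (co)actions: $\mu_l=\varepsilon_2\otimes\mathrm{id}_1$, $\mu_r=\mathrm{id}_2\otimes\varepsilon_1$, $\nu_l=\eta_2\otimes\mathrm{id}_1$, $\nu_r=\mathrm{id}_2\otimes\eta_1$. A Hopf datum is trivalent if at least one (co)action is trivial; then $B=B_1\otimes B_2$ is a bialgebra with $\mathrm m_B=(\mathrm m_1\otimes\mathrm m_2)(\mathrm{id}_1\otimes\phi_{2,1}\otimes\mathrm{id}_2)$, $\Delta_B=(\mathrm{id}_1\otimes\phi_{1,2}\otimes\mathrm{id}_2)(\Delta_1\otimes\Delta_2)$, $\eta_B=\eta_1\otimes\eta_2$, $\varepsilon_B=\varepsilon_1\otimes\varepsilon_2$. Left crossed modules over a bialgebra $H$: objects $M$ with a left $H$-action $\mu_l$ and left $H$-coaction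 $\nu_l$ such that $(\mathrm m_H\otimes\mu_l)(\mathrm{id}_H\otimes\Psi_{H,H}\otimes\mathrm{id}_M)(\Delta_H\otimes\nu_l)=(\mathrm m_H\otimes\mathrm{id}_M)(\mathrm{id}_H\otimes\Psi_{M,H})(\nu_l\mu_l\otimes\mathrm{id}_H)(\mathrm{id}_H\otimes\Psi_{H,M})(\Delta_H\otimes\mathrm{id}_M)$; the category is monoidal with $\otimes$, $I$ and diagonal (co)actions, and bialgebras in it are formed with the (pre-)braiding $(\mu_l^N\otimes\mathrm{id}_M)(\mathrm{id}_H\otimes\Psi_{M,N})(\nu_l^M\otimes\mathrm{id}_N):M\otimes N\to N\otimes M$. *)

(* Defs.v *)
Set Implicit Arguments.
Unset Strict Implicit.
Unset Printing Implicit Defensive.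

(* Categories are presented with a single type of morphisms, so that the
   equalities (A ⊗ B) ⊗ C = A ⊗ (B ⊗ C) and (f ⊗ g) ⊗ h = f ⊗ (g ⊗ h) of a strict
   monoidal category are plain equalities, without transport between hom types.
   [f : A -> B] is the proposition [hom A B f].  Composition is a total function,
   but the axioms only concern composable morphisms: the value of [comp g f] for
   non-composable [g] and [f] is irrelevant. *)
Record quiver := Quiver {
  ob : Type;
  mor : Type;
  dom : mor -> ob;
  cod : mor -> ob
}.

Definition hom (Q : quiver) (A B : ob Q) (f : mor Q) : Prop :=
  dom f = A /\ cod f = B.

Record category := Category {
  cat_quiver :> quiver;
  idm : ob cat_quiver -> mor cat_quiver;
  comp : mor cat_quiver -> mor cat_quiver -> mor cat_quiver;
  hom_idm : forall A, hom A A (idm A);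
  hom_comp : forall A B C f g, hom A B f -> hom B C g -> hom A C (comp g f);
  comp_idl : forall A B f, hom A B f -> comp (idm B) f = f;
  comp_idr : forall A B f, hom A B f -> comp f (idm A) = f;
  compA : forall A B C D f g h, hom A B f -> hom B C g -> hom C D h ->
    comp h (comp g f) = comp (comp h g) f
}.

Declare Scope ob_scope.
Declare Scope mor_scope.
Delimit Scope ob_scope with ob.
Delimit Scope mor_scope with mor.
Bind Scope ob_scope with ob.
Bind Scope mor_scope with mor.

Notation "g ∘ f" := (comp g f) (at level 40, left associativity) : mor_scope.

Record strict_monoidal_category := StrictMonoidalCategory {
  mon_category :> category;
  unit_ob : ob mon_category;
  tens_ob : ob mon_category -> ob mon_category -> ob mon_category;
  tens : mor mon_category -> mor mon_category -> mor mon_category;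
  tens_obA : forall A B C, tens_ob A (tens_ob B C) = tens_ob (tens_ob A B) C;
  tens_ob1l : forall A, tens_ob unit_ob A = A;
  tens_ob1r : forall A, tens_ob A unit_ob = A;
  hom_tens : forall A B A' B' f f', hom A B f -> hom A' B' f' ->
    hom (tens_ob A A') (tens_ob B B') (tens f f');
  tens_idm : forall A B, tens (idm A) (idm B) = idm (tens_ob A B);
  tens_comp : forall A B C A' B' C' f g f' g',
    hom A B f -> hom B C g -> hom A' B' f' -> hom B' C' g' ->
    tens (comp g f) (comp g' f') = comp (tens g g') (tens f f');
  tensA : forall f g h, tens f (tens g h) = tens (tens f g) h;
  tens_1l : forall f, tens (idm unit_ob) f = f;
  tens_1r : forall f, tens f (idm unit_ob) = f
}.

Notation "A ⊗ B" := (tens_ob A B) (at level 37, left associativity) : ob_scope.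
Notation "f ⊗ g" := (tens f g) (at level 37, left associativity) : mor_scope.

Definition is_iso (C : category) (A B : ob C) (f : mor C) : Prop :=
  hom A B f /\
  exists g, hom B A g /\ comp g f = idm A /\ comp f g = idm B.

Local Open Scope mor_scope.

Record braided_category := BraidedCategory {
  br_monoidal :> strict_monoidal_category;
  braid : ob br_monoidal -> ob br_monoidal -> mor br_monoidal;
  braid_iso : forall A B, is_iso (A ⊗ B)%ob (B ⊗ A)%ob (braid A B);
  braid_natural : forall A B A' B' f f', hom A B f -> hom A' B' f' ->
    braid B B' ∘ (f ⊗ f') = (f' ⊗ f) ∘ braid A A';
  braid_tensl : forall A B D,
    braid (A ⊗ B)%ob D = (braid A D ⊗ idm B) ∘ (idm A ⊗ braid B D);
  braid_tensr : forall A B D,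
    braid A (B ⊗ D)%ob = (idm B ⊗ braid A D) ∘ (braid A B ⊗ idm D)
}.

Notation Ψ := braid.

Definition idempotents_split (C : category) : Prop :=
  forall (A : ob C) (e : mor C), hom A A e -> e ∘ e = e ->
  exists (B : ob C) (p i : mor C),
    hom A B p /\ hom B A i /\ i ∘ p = e /\ p ∘ i = idm B.

(* An object with the underlying data of an algebra and of a coalgebra. *)
Record bialg_data (C : braided_category) := BialgData {
  carrier :> ob C;
  mult : mor C;
  unit : mor C;
  comult : mor C;
  counit : mor C
}.

Section Bialgebras.
Context {C : braided_category}.
Notation I := (unit_ob C).

Record is_algebra (A : bialg_data C) : Prop := {
  mult_hom : hom (A ⊗ A)%ob A (mult A);
  unit_hom : hom I A (unit A);
  mult_assoc : mult A ∘ (mult A ⊗ idm A) = mult A ∘ (idm A ⊗ mult A);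
  mult_unitl : mult A ∘ (unit A ⊗ idm A) = idm A;
  mult_unitr : mult A ∘ (idm A ⊗ unit A) = idm A
}.

Record is_coalgebra (A : bialg_data C) : Prop := {
  comult_hom : hom A (A ⊗ A)%ob (comult A);
  counit_hom : hom A I (counit A);
  comult_coassoc :
    (comult A ⊗ idm A) ∘ comult A = (idm A ⊗ comult A) ∘ comult A;
  comult_counitl : (counit A ⊗ idm A) ∘ comult A = idm A;
  comult_counitr : (idm A ⊗ counit A) ∘ comult A = idm A
}.

Definition counit_algebra_morphism (A : bialg_data C) : Prop :=
  counit A ∘ mult A = counit A ⊗ counit A /\ counit A ∘ unit A = idm I.

Definition unit_coalgebra_morphism (A : bialg_data C) : Prop :=
  comult A ∘ unit A = unit A ⊗ unit A /\ counit A ∘ unit A = idm I.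

(* [X : A ⊗ A -> A ⊗ A] is the (pre-)braiding with respect to which the
   compatibility of multiplication and comultiplication is expressed. *)
Record is_bialgebra_for (X : mor C) (A : bialg_data C) : Prop := {
  bialg_algebra : is_algebra A;
  bialg_coalgebra : is_coalgebra A;
  bialg_compat : comult A ∘ mult A =
    (mult A ⊗ mult A) ∘ (idm A ⊗ X ⊗ idm A) ∘ (comult A ⊗ comult A);
  bialg_counit : counit_algebra_morphism A;
  bialg_unit : unit_coalgebra_morphism A
}.

Definition is_bialgebra (A : bialg_data C) : Prop := is_bialgebra_for (Ψ A A) A.

Record is_left_module (H : bialg_data C) (M : ob C) (μ : mor C) : Prop := {
  lmod_hom : hom (H ⊗ M)%ob M μ;
  lmod_assoc : μ ∘ (mult H ⊗ idm M) = μ ∘ (idm H ⊗ μ);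
  lmod_unit : μ ∘ (unit H ⊗ idm M) = idm M
}.

Record is_right_module (H : bialg_data C) (M : ob C) (μ : mor C) : Prop := {
  rmod_hom : hom (M ⊗ H)%ob M μ;
  rmod_assoc : μ ∘ (idm M ⊗ mult H) = μ ∘ (μ ⊗ idm H);
  rmod_unit : μ ∘ (idm M ⊗ unit H) = idm M
}.

Record is_left_comodule (H : bialg_data C) (M : ob C) (ν : mor C) : Prop := {
  lcomod_hom : hom M (H ⊗ M)%ob ν;
  lcomod_coassoc : (comult H ⊗ idm M) ∘ ν = (idm H ⊗ ν) ∘ ν;
  lcomod_counit : (counit H ⊗ idm M) ∘ ν = idm M
}.

Record is_right_comodule (H : bialg_data C) (M : ob C) (ν : mor C) : Prop := {
  rcomod_hom : hom M (M ⊗ H)%ob ν;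
  rcomod_coassoc : (idm M ⊗ comult H) ∘ ν = (ν ⊗ idm H) ∘ ν;
  rcomod_counit : (idm M ⊗ counit H) ∘ ν = idm M
}.

Definition left_module_morphism (H : bialg_data C) (M N : ob C)
    (μM μN f : mor C) : Prop :=
  hom M N f /\ f ∘ μM = μN ∘ (idm H ⊗ f).

Definition right_module_morphism (H : bialg_data C) (M N : ob C)
    (μM μN f : mor C) : Prop :=
  hom M N f /\ f ∘ μM = μN ∘ (f ⊗ idm H).

Definition left_comodule_morphism (H : bialg_data C) (M N : ob C)
    (νM νN f : mor C) : Prop :=
  hom M N f /\ νN ∘ f = (idm H ⊗ f) ∘ νM.

Definition right_comodule_morphism (H : bialg_data C) (M N : ob C)
    (νM νN f : mor C) : Prop :=
  hom M N f /\ νN ∘ f = (f ⊗ idm H) ∘ νM.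

(* On the unit object, the diagonal actions are [counit H : H -> I] and the
   diagonal coactions are [unit H : I -> H], since [H ⊗ I = H = I ⊗ H]. *)

Definition diag_left_action (H : bialg_data C) (M N : ob C) (μM μN : mor C) :=
  (μM ⊗ μN) ∘ (idm H ⊗ Ψ H M ⊗ idm N) ∘ (comult H ⊗ idm M ⊗ idm N).

Definition diag_right_action (H : bialg_data C) (M N : ob C) (μM μN : mor C) :=
  (μM ⊗ μN) ∘ (idm M ⊗ Ψ N H ⊗ idm H) ∘ (idm M ⊗ idm N ⊗ comult H).

Definition diag_left_coaction (H : bialg_data C) (M N : ob C) (νM νN : mor C) :=
  (mult H ⊗ idm M ⊗ idm N) ∘ (idm H ⊗ Ψ M H ⊗ idm N) ∘ (νM ⊗ νN).

Definition diag_right_coaction (H : bialg_data C) (M N : ob C) (νM νN : mor C) :=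
  (idm M ⊗ idm N ⊗ mult H) ∘ (idm M ⊗ Ψ H N ⊗ idm H) ∘ (νM ⊗ νN).

Record is_left_module_coalgebra (H A : bialg_data C) (μ : mor C) : Prop := {
  lmc_module : is_left_module H A μ;
  lmc_coalgebra : is_coalgebra A;
  lmc_comult : left_module_morphism H A (A ⊗ A)%ob
                 μ (diag_left_action H A A μ μ) (comult A);
  lmc_counit : left_module_morphism H A I μ (counit H) (counit A)
}.

Record is_right_module_coalgebra (H A : bialg_data C) (μ : mor C) : Prop := {
  rmc_module : is_right_module H A μ;
  rmc_coalgebra : is_coalgebra A;
  rmc_comult : right_module_morphism H A (A ⊗ A)%ob
                 μ (diag_right_action H A A μ μ) (comult A);
  rmc_counit : right_module_morphism H A I μ (counit H) (counit A)
}.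

Record is_right_module_algebra (H A : bialg_data C) (μ : mor C) : Prop := {
  rma_module : is_right_module H A μ;
  rma_algebra : is_algebra A;
  rma_mult : right_module_morphism H (A ⊗ A)%ob A
               (diag_right_action H A A μ μ) μ (mult A);
  rma_unit : right_module_morphism H I A (counit H) μ (unit A)
}.

Record is_left_comodule_coalgebra (H A : bialg_data C) (ν : mor C) : Prop := {
  lcc_comodule : is_left_comodule H A ν;
  lcc_coalgebra : is_coalgebra A;
  lcc_comult : left_comodule_morphism H A (A ⊗ A)%ob
                 ν (diag_left_coaction H A A ν ν) (comult A);
  lcc_counit : left_comodule_morphism H A I ν (unit H) (counit A)
}.

Record is_right_comodule_algebra (H A : bialg_data C) (ν : mor C) : Prop := {
  rca_comodule : is_right_comodule H A ν;
  rca_algebra : is_algebra A;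
  rca_mult : right_comodule_morphism H (A ⊗ A)%ob A
               (diag_right_coaction H A A ν ν) ν (mult A);
  rca_unit : right_comodule_morphism H I A (unit H) ν (unit A)
}.

Record is_crossed_module (H : bialg_data C) (M : ob C) (μ ν : mor C) : Prop := {
  crossed_module : is_left_module H M μ;
  crossed_comodule : is_left_comodule H M ν;
  crossed_compat :
    (mult H ⊗ μ) ∘ (idm H ⊗ Ψ H H ⊗ idm M) ∘ (comult H ⊗ ν)
    = (mult H ⊗ idm M) ∘ (idm H ⊗ Ψ M H) ∘ ((ν ∘ μ) ⊗ idm H)
        ∘ (idm H ⊗ Ψ H M) ∘ (comult H ⊗ idm M)
}.

Definition crossed_morphism (H : bialg_data C) (M N : ob C)
    (μM νM μN νN f : mor C) : Prop :=
  left_module_morphism H M N μM μN f /\ left_comodule_morphism H M N νM νN f.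

Definition crossed_braid (H : bialg_data C) (M N : ob C) (νM μN : mor C) :=
  (μN ⊗ idm M) ∘ (idm H ⊗ Ψ M N) ∘ (νM ⊗ idm N).

(* Bialgebras in the monoidal category of left crossed modules over the
   bialgebra [H], formed with its (pre-)braiding [crossed_braid]. *)
Record is_crossed_bialgebra (H A : bialg_data C) (μ ν : mor C) : Prop := {
  crossed_bialg_module : is_crossed_module H A μ ν;
  crossed_bialg_mult : crossed_morphism H (A ⊗ A)%ob A
    (diag_left_action H A A μ μ) (diag_left_coaction H A A ν ν) μ ν (mult A);
  crossed_bialg_unit :
    crossed_morphism H I A (counit H) (unit H) μ ν (unit A);
  crossed_bialg_comult : crossed_morphism H A (A ⊗ A)%ob
    μ ν (diag_left_action H A A μ μ) (diag_left_coaction H A A ν ν) (comult A);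
  crossed_bialg_counit :
    crossed_morphism H A I μ ν (counit H) (unit H) (counit A);
  crossed_bialg_bialgebra : is_bialgebra_for (crossed_braid H A A ν μ) A
}.

(* Meant for [φ21 : A2 ⊗ A1 -> A1 ⊗ A2] and [φ12 : A1 ⊗ A2 -> A2 ⊗ A1]. *)
Definition cross_product (A1 A2 : bialg_data C) (φ21 φ12 : mor C) : bialg_data C :=
  {| carrier := (A1 ⊗ A2)%ob;
     mult := (mult A1 ⊗ mult A2) ∘ (idm A1 ⊗ φ21 ⊗ idm A2);
     unit := unit A1 ⊗ unit A2;
     comult := (idm A1 ⊗ φ12 ⊗ idm A2) ∘ (comult A1 ⊗ comult A2);
     counit := counit A1 ⊗ counit A2 |}.

Definition tensor_product (A1 A2 : bialg_data C) : bialg_data C :=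
  cross_product A1 A2 (Ψ A2 A1) (Ψ A1 A2).

End Bialgebras.

Record hopf_data (C : braided_category) := HopfData {
  B1 : bialg_data C;
  B2 : bialg_data C;
  mu_l : mor C;
  nu_l : mor C;
  mu_r : mor C;
  nu_r : mor C
}.

Section HopfDatum.
Context {C : braided_category} (D : hopf_data C).

Local Notation m1 := (mult (B1 D)).
Local Notation m2 := (mult (B2 D)).
Local Notation η1 := (unit (B1 D)).
Local Notation η2 := (unit (B2 D)).
Local Notation Δ1 := (comult (B1 D)).
Local Notation Δ2 := (comult (B2 D)).
Local Notation ε1 := (counit (B1 D)).
Local Notation ε2 := (counit (B2 D)).
Local Notation id1 := (idm (B1 D)).
Local Notation id2 := (idm (B2 D)).
Local Notation Ψ11 := (Ψ (B1 D) (B1 D)).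
Local Notation Ψ12 := (Ψ (B1 D) (B2 D)).
Local Notation Ψ21 := (Ψ (B2 D) (B1 D)).
Local Notation Ψ22 := (Ψ (B2 D) (B2 D)).
Local Notation μl := (mu_l D).
Local Notation νl := (nu_l D).
Local Notation μr := (mu_r D).
Local Notation νr := (nu_r D).

Definition phi12 : mor C := (m2 ⊗ m1) ∘ (id2 ⊗ Ψ12 ⊗ id1) ∘ (νl ⊗ νr).
Definition phi21 : mor C := (μl ⊗ μr) ∘ (id2 ⊗ Ψ21 ⊗ id1) ∘ (Δ2 ⊗ Δ1).

Record is_hopf_datum : Prop := {
  hd_algebra1 : is_algebra (B1 D);
  hd_coalgebra1 : is_coalgebra (B1 D);
  hd_counit1 : counit_algebra_morphism (B1 D);
  hd_unit1 : unit_coalgebra_morphism (B1 D);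
  hd_algebra2 : is_algebra (B2 D);
  hd_coalgebra2 : is_coalgebra (B2 D);
  hd_counit2 : counit_algebra_morphism (B2 D);
  hd_unit2 : unit_coalgebra_morphism (B2 D);
  hd_lmodule : is_left_module (B2 D) (B1 D) μl;
  hd_lcomodule : is_left_comodule (B2 D) (B1 D) νl;
  hd_rmodule : is_right_module (B1 D) (B2 D) μr;
  hd_rcomodule : is_right_comodule (B1 D) (B2 D) νr;
  hd_mur_unit : μr ∘ (η2 ⊗ id1) = η2 ∘ ε1;
  hd_nul_counit : (id2 ⊗ ε1) ∘ νl = η2 ∘ ε1;
  hd_counit_mur : ε2 ∘ μr = ε2 ⊗ ε1;
  hd_counit_mul : ε1 ∘ μl = ε2 ⊗ ε1;
  hd_mul_unit : μl ∘ (id2 ⊗ η1) = η1 ∘ ε2;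
  hd_nur_counit : (ε2 ⊗ id1) ∘ νr = η1 ∘ ε2;
  hd_nur_unit : νr ∘ η2 = η2 ⊗ η1;
  hd_nul_unit : νl ∘ η1 = η2 ⊗ η1;
  hd_algebra_coalgebra1 : Δ1 ∘ m1 =
    (m1 ⊗ m1) ∘ (id1 ⊗ μl ⊗ id1 ⊗ id1) ∘ (id1 ⊗ id2 ⊗ Ψ11 ⊗ id1)
      ∘ (id1 ⊗ νl ⊗ id1 ⊗ id1) ∘ (Δ1 ⊗ Δ1);
  hd_algebra_coalgebra2 : Δ2 ∘ m2 =
    (m2 ⊗ m2) ∘ (id2 ⊗ id2 ⊗ μr ⊗ id2) ∘ (id2 ⊗ Ψ22 ⊗ id1 ⊗ id2)
      ∘ (id2 ⊗ id2 ⊗ νr ⊗ id2) ∘ (Δ2 ⊗ Δ2);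
  hd_module_comodule : phi12 ∘ phi21 =
    (m2 ⊗ m1) ∘ (μr ⊗ Ψ12 ⊗ μl) ∘ (id2 ⊗ Ψ11 ⊗ Ψ22 ⊗ id1)
      ∘ (νr ⊗ Ψ21 ⊗ νl) ∘ (Δ2 ⊗ Δ1);
  hd_module_algebra_r :
    μr ∘ (m2 ⊗ id1) = m2 ∘ (μr ⊗ id2) ∘ (id2 ⊗ phi21);
  hd_module_algebra_l :
    μl ∘ (id2 ⊗ m1) = m1 ∘ (id1 ⊗ μl) ∘ (phi21 ⊗ id1);
  hd_comodule_coalgebra_r :
    (Δ2 ⊗ id1) ∘ νr = (id2 ⊗ phi12) ∘ (νr ⊗ id2) ∘ Δ2;
  hd_comodule_coalgebra_l :
    (id2 ⊗ Δ1) ∘ νl = (phi12 ⊗ id1) ∘ (id1 ⊗ νl) ∘ Δ1;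
  hd_module_coalgebra_r : Δ2 ∘ μr =
    (m2 ⊗ μr) ∘ (μr ⊗ Ψ22 ⊗ id1) ∘ (id2 ⊗ Ψ21 ⊗ νl) ∘ (Δ2 ⊗ Δ1);
  hd_module_coalgebra_l : Δ1 ∘ μl =
    (μl ⊗ m1) ∘ (id2 ⊗ Ψ11 ⊗ μl) ∘ (νr ⊗ Ψ21 ⊗ id1) ∘ (Δ2 ⊗ Δ1);
  hd_comodule_algebra_r : νr ∘ m2 =
    (m2 ⊗ m1) ∘ (id2 ⊗ Ψ12 ⊗ μl) ∘ (νr ⊗ Ψ22 ⊗ id1) ∘ (Δ2 ⊗ νr);
  hd_comodule_algebra_l : νl ∘ m1 =
    (m2 ⊗ m1) ∘ (μr ⊗ Ψ12 ⊗ id1) ∘ (id2 ⊗ Ψ11 ⊗ νl) ∘ (νl ⊗ Δ1)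
}.

Definition mu_l_trivial : Prop := μl = ε2 ⊗ id1.
Definition mu_r_trivial : Prop := μr = id2 ⊗ ε1.
Definition nu_l_trivial : Prop := νl = η2 ⊗ id1.
Definition nu_r_trivial : Prop := νr = id2 ⊗ η1.

Definition hopf_bialgebra : bialg_data C :=
  cross_product (B1 D) (B2 D) phi21 phi12.

(* [phi21] when [mu_r] is trivial, resp. [phi12] when [nu_r] is trivial *)
Definition biproduct_phi21 : mor C := (μl ⊗ id2) ∘ (id2 ⊗ Ψ21) ∘ (Δ2 ⊗ id1).
Definition biproduct_phi12 : mor C := (m2 ⊗ id1) ∘ (id2 ⊗ Ψ12) ∘ (νl ⊗ id2).

(* [phi21] when [mu_l] is trivial *)
Definition smash_phi21 : mor C := (id1 ⊗ μr) ∘ (Ψ21 ⊗ id1) ∘ (id2 ⊗ Δ1).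

Record is_matched_pair : Prop := {
  mp_bialgebra1 : is_bialgebra (B1 D);
  mp_bialgebra2 : is_bialgebra (B2 D);
  mp_lmodule_coalgebra : is_left_module_coalgebra (B2 D) (B1 D) μl;
  mp_rmodule_coalgebra : is_right_module_coalgebra (B1 D) (B2 D) μr;
  mp_mur_mult : μr ∘ (m2 ⊗ id1) = m2 ∘ (μr ⊗ id2) ∘ (id2 ⊗ phi21);
  mp_mur_unit : μr ∘ (η2 ⊗ id1) = η2 ∘ ε1;
  mp_mul_mult : μl ∘ (id2 ⊗ m1) = m1 ∘ (id1 ⊗ μl) ∘ (phi21 ⊗ id1);
  mp_mul_unit : μl ∘ (id2 ⊗ η1) = η1 ∘ ε2;
  mp_compat : (μr ⊗ μl) ∘ (id2 ⊗ Ψ21 ⊗ id1) ∘ (Δ2 ⊗ Δ1) = Ψ12 ∘ phi21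
}.

Record is_bicross_datum : Prop := {
  bc_bialgebra1 : is_bialgebra (B1 D);
  bc_bialgebra2 : is_bialgebra (B2 D);
  bc_comodule_coalgebra : is_left_comodule_coalgebra (B2 D) (B1 D) νl;
  bc_module_algebra : is_right_module_algebra (B1 D) (B2 D) μr;
  bc_counit_mur : ε2 ∘ μr = ε2 ⊗ ε1;
  bc_nul_unit : νl ∘ η1 = η2 ⊗ η1;
  bc_compat :
    (m2 ⊗ id1) ∘ (id2 ⊗ Ψ12) ∘ (νl ⊗ μr) ∘ (Ψ21 ⊗ id1) ∘ (id2 ⊗ Δ1)
    = (m2 ⊗ id1) ∘ (μr ⊗ νl) ∘ (id2 ⊗ Δ1);
  bc_comult_mur : Δ2 ∘ μr =
    (m2 ⊗ μr) ∘ (μr ⊗ Ψ22 ⊗ id1) ∘ (id2 ⊗ Ψ21 ⊗ νl) ∘ (Δ2 ⊗ Δ1);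
  bc_nul_mult : νl ∘ m1 =
    (m2 ⊗ m1) ∘ (μr ⊗ Ψ12 ⊗ id1) ∘ (id2 ⊗ Ψ11 ⊗ νl) ∘ (νl ⊗ Δ1)
}.

Record is_mu_l_trivial_datum : Prop := {
  lt_bialgebra1 : is_bialgebra (B1 D);
  lt_comodule1 : is_left_comodule (B2 D) (B1 D) νl;
  lt_algebra2 : is_algebra (B2 D);
  lt_counit2 : counit_algebra_morphism (B2 D);
  lt_module_algebra2 : is_right_module_algebra (B1 D) (B2 D) μr;
  lt_comodule_algebra2 : is_right_comodule_algebra (B1 D) (B2 D) νr;
  lt_coalgebra2 : is_coalgebra (B2 D);
  lt_unit2 : unit_coalgebra_morphism (B2 D);
  lt_counit_mur : ε2 ∘ μr = ε2 ⊗ ε1;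
  lt_nul_unit : νl ∘ η1 = η2 ⊗ η1;
  lt_nur_counit : (ε2 ⊗ id1) ∘ νr = η1 ∘ ε2;
  lt_nul_counit : (id2 ⊗ ε1) ∘ νl = η2 ∘ ε1;
  lt_algebra_coalgebra2 : Δ2 ∘ m2 =
    (m2 ⊗ m2) ∘ (id2 ⊗ id2 ⊗ μr ⊗ id2) ∘ (id2 ⊗ Ψ22 ⊗ id1 ⊗ id2)
      ∘ (id2 ⊗ id2 ⊗ νr ⊗ id2) ∘ (Δ2 ⊗ Δ2);
  lt_compat :
    phi12 ∘ (id1 ⊗ μr) ∘ (Ψ21 ⊗ id1) ∘ (id2 ⊗ Δ1) =
    (m2 ⊗ m1) ∘ (μr ⊗ Ψ12 ⊗ id1) ∘ (id2 ⊗ Ψ11 ⊗ νl) ∘ (νr ⊗ Δ1);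
  lt_comult_nur : (Δ2 ⊗ id1) ∘ νr = (id2 ⊗ phi12) ∘ (νr ⊗ id2) ∘ Δ2;
  lt_comult_nul : (id2 ⊗ Δ1) ∘ νl = (phi12 ⊗ id1) ∘ (id1 ⊗ νl) ∘ Δ1;
  lt_comult_mur : Δ2 ∘ μr =
    (m2 ⊗ μr) ∘ (μr ⊗ Ψ22 ⊗ id1) ∘ (id2 ⊗ Ψ21 ⊗ νl) ∘ (Δ2 ⊗ Δ1);
  lt_nul_mult : νl ∘ m1 =
    (m2 ⊗ m1) ∘ (μr ⊗ Ψ12 ⊗ id1) ∘ (id2 ⊗ Ψ11 ⊗ νl) ∘ (νl ⊗ Δ1)
}.

End HopfDatum.

(* Main.v *)
(** Equations between composites are proved by rewriting string diagrams, up to planar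
    isotopy and naturality of the braiding.  Once the prescribed (co)actions are trivial,
    the axioms of a Hopf datum turn into those of the equivalent description by (co)unit
    identities alone.

    That [B] is a bialgebra is proved directly when [μl] is trivial.  The maps [φ21] and
    [φ12] are then distributive over the (co)multiplications, so [B] is an algebra and a
    coalgebra.  As [B] is generated by [B1] and [B2], the multiplicativity of [Δ_B] only
    has to be checked on the four kinds of products of one factor of [B1] or [B2] with
    another.  Passing to the opposite category exchanges [μ] with [ν], and reversing the
    tensor product exchanges [l] with [r] and [B1] with [B2]; this reduces trivial [νl]
    and trivial [μr] to trivial [μl]. *)

From Stdlib Require Import List Arith Lia Bool ssreflect ssrfun ssrbool.
Require Import Defs.
Import ListNotations.
Set Implicit Arguments.
Unset Strict Implicit.
Unset Printing Implicit Defensive.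
Local Open Scope mor_scope.

(** * Diagrams as lists of layers *)

(** The obstacle is size: the identities are long composites that agree only after interchange,
    hexagon and naturality moves, so they are settled by reflection. Types become words of wires,
    which turns strictness into equality of lists. The search for a redex is untrusted and each step
    is rechecked up to interchange, so a bad search can make a proof fail but never validate a false
    equation. Two consequences shape the rest. Rewriting needs the types of all cells, so each
    description of a Hopf datum must first yield the record [hopf_units], which also supplies the
    rules for units and counits. For the multiplicativity of [Δ_B], the passage to generators rests
    on the associativity of [B ⊗ B], where [B ⊗ B] carries the braided multiplication. The product
    of a factor of [B2] by one of [B1] is the case where the module-comodule axiom enters. *)

Inductive oexpr := OUnit | OWire (n : nat) | OTens (a b : oexpr).

Fixpoint wires (o : oexpr) : list nat :=
  match o with
  | OUnit => []
  | OWire n => [n]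
  | OTens a b => wires a ++ wires b
  end.

(** Crossings are separate from cells because they exist for every pair of wire types; braidings of
    composite objects are expanded into them. *)
Inductive gen := Cell (n : nat) | Cross (i j : nat).

Inductive expr :=
  | EId (o : oexpr)
  | ECell (n : nat)
  | EBraid (a b : oexpr)
  | EComp (e f : expr)
  | ETens (e f : expr).

(* [(n, g)] is [g] with [n] wires on its left; in a diagram the first layer is
   applied first. *)
Definition layer : Type := nat * gen.
Definition diagram := list layer.

Definition gen_eqb (g h : gen) : bool :=
  match g, h with
  | Cell m, Cell n => m =? n
  | Cross i j, Cross k l => (i =? k) && (j =? l)
  | _, _ => false
  end.

Lemma gen_eqb_eq g h : gen_eqb g h = true -> g = h.
Proof.
case: g => [m|i j]; case: h => [n|k l] //= H.
- by rewrite (proj1 (Nat.eqb_eq _ _) H).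
- case/andb_prop: H => H1 H2.
  by rewrite (proj1 (Nat.eqb_eq _ _) H1) (proj1 (Nat.eqb_eq _ _) H2).
Qed.

Fixpoint word_eqb (u v : list nat) : bool :=
  match u, v with
  | [], [] => true
  | i :: u, j :: v => (i =? j) && word_eqb u v
  | _, _ => false
  end.

Lemma word_eqb_eq u v : word_eqb u v = true -> u = v.
Proof.
elim: u v => [|i u IH] [|j v] //= /andb_prop [H1 /IH ->].
by rewrite (proj1 (Nat.eqb_eq _ _) H1).
Qed.

Definition shift (k : nat) (d : diagram) : diagram :=
  map (fun x => (k + fst x, snd x)) d.

Lemma shift0 d : shift 0 d = d.
Proof. by rewrite -[RHS]map_id; apply: map_ext; case. Qed.

Fixpoint cross_right (c : nat) (ws : list nat) (k : nat) : diagram :=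
  match ws with
  | [] => []
  | w :: ws => (k, Cross c w) :: cross_right c ws (S k)
  end.

(** This unfolds [braid_tensl]: the tail of [u] crosses [v] first, next to the idle wire [c], and
    then [c] crosses. *)
Fixpoint braid_words (u v : list nat) : diagram :=
  match u with
  | [] => []
  | c :: u => shift 1 (braid_words u v) ++ cross_right c v 0
  end.

Lemma word_segment n w s :
  (n <=? length w) && word_eqb (firstn (length s) (skipn n w)) s = true ->
  w = firstn n w ++ s ++ skipn (n + length s) w /\ length (firstn n w) = n.
Proof.
case/andb_prop => /Nat.leb_le Hn /word_eqb_eq Hs; split; last by rewrite length_firstn; lia.
rewrite -{1}(firstn_skipn n w); congr (_ ++ _).
by rewrite -{1}(firstn_skipn (length s) (skipn n w)) Hs skipn_skipn Nat.add_comm.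
Qed.

Lemma segment_word u s v : let w := u ++ s ++ v in
  ((length u <=? length w) && word_eqb (firstn (length s) (skipn (length u) w)) s = true)
  /\ firstn (length u) w = u /\ skipn (length u + length s) w = v.
Proof.
have Heq x : word_eqb x x = true by elim: x => //= i x ->; rewrite Nat.eqb_refl.
move=> w.
have E1 : firstn (length u) w = u by rewrite /w firstn_app Nat.sub_diag firstn_all firstn_O app_nil_r.
have E2 : skipn (length u) w = s ++ v by rewrite /w skipn_app Nat.sub_diag skipn_all skipn_O.
have E3 : firstn (length s) (s ++ v) = s by rewrite firstn_app Nat.sub_diag firstn_all firstn_O app_nil_r.
split; [|split] => //.
  rewrite E2 E3 Heq andb_true_r; apply/Nat.leb_le; rewrite /w length_app; lia.
by rewrite Nat.add_comm -skipn_skipn E2 skipn_app Nat.sub_diag skipn_all skipn_O.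
Qed.

Lemma app_eq_prefix (T : Type) (a b c d : list T) :
  a ++ b = c ++ d -> length a <= length c -> exists x, c = a ++ x /\ b = x ++ d.
Proof.
elim: a c => [|i a IH] c /= E Hlen; first by exists c.
case: c E Hlen => [|j c] /= E Hlen; first by lia.
case: E => -> /IH [|x [-> ->]]; first by lia.
by exists x.
Qed.

(* Unlike with [existsb], evaluation by value stops at the first success. *)
Definition any {A : Type} (f : A -> bool) : list A -> bool :=
  fix go l := match l with [] => false | x :: l => if f x then true else go l end.

Lemma any_exists (A : Type) (f : A -> bool) l : any f l = true -> exists2 x, In x l & f x = true.
Proof.
elim: l => //= x l IH; case E: (f x) => H; first by exists x => //; left.
by case: (IH H) => y H1 H2; exists y => //; right.
Qed.

(** * Typing of diagrams, interchange and the search for redexes *)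

Section Syntax.
Variable ar : list (list nat * list nat).

Definition src (g : gen) : list nat :=
  match g with
  | Cell n => fst (nth n ar ([], []))
  | Cross i j => [i; j]
  end.

Definition tgt (g : gen) : list nat :=
  match g with
  | Cell n => snd (nth n ar ([], []))
  | Cross i j => [j; i]
  end.

(** For a generator without inputs the word comparison succeeds at any position; the bound on [n]
    keeps it inside the word. *)
Definition step (w : list nat) (x : layer) : option (list nat) :=
  let (n, g) := x in
  if (n <=? length w) && word_eqb (firstn (length (src g)) (skipn n w)) (src g)
  then Some (firstn n w ++ tgt g ++ skipn (n + length (src g)) w)
  else None.

Lemma step_spec w n g w' : step w (n, g) = Some w' ->
  exists u v, [/\ length u = n, w = u ++ src g ++ v & w' = u ++ tgt g ++ v].
Proof.
rewrite /step; case E: (_ && _) => // -[<-].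
case: (word_segment E) => E1 E2.
by exists (firstn n w), (skipn (n + length (src g)) w).
Qed.

Lemma step_word u g v :
  step (u ++ src g ++ v) (length u, g) = Some (u ++ tgt g ++ v).
Proof. by rewrite /step; case: (segment_word u (src g) v) => /= -> [-> ->]. Qed.

Fixpoint run (w : list nat) (d : diagram) : option (list nat) :=
  match d with
  | [] => Some w
  | x :: d => match step w x with Some w' => run w' d | None => None end
  end.

(* Both interchanges are possible when [x] has no output and [y] no input. *)
Definition swaps (x y : layer) : list (layer * layer) :=
  let (n, g) := x in
  let (m, h) := y in
  (if n + length (tgt g) <=? m then
    [((m - length (tgt g) + length (src g), h), (n, g))] else [])
  ++
  (if m + length (src h) <=? n then
    [((m, h), (n - length (src h) + length (tgt h), g))] else []).

Definition to_front (d : diagram) (y : layer) : list (layer * diagram) :=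
  fold_right (fun x ps =>
    flat_map (fun p => map (fun q => (fst q, snd q :: snd p)) (swaps x (fst p))) ps)
    [(y, [])] d.

Definition layer_eqb (x y : layer) : bool :=
  (fst x =? fst y) && gen_eqb (snd x) (snd y).

Lemma layer_eqb_eq x y : layer_eqb x y = true -> x = y.
Proof.
case: x y => [n g] [m h] /andb_prop [/= H1 H2].
by rewrite (proj1 (Nat.eqb_eq _ _) H1) (gen_eqb_eq H2).
Qed.

Fixpoint fronts (acc d : diagram) : list (layer * diagram) :=
  match d with
  | [] => []
  | y :: d' =>
      map (fun p => (fst p, snd p ++ d')) (to_front acc y) ++ fronts (acc ++ [y]) d'
  end.

(** The first layer of [d] is cancelled against an equal layer of [d'] that interchange can bring to
    the front. Several layers may qualify, hence the backtracking. *)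
Fixpoint isotopic (d d' : diagram) : bool :=
  match d with
  | [] => match d' with [] => true | _ => false end
  | x :: d =>
      any (fun p => if layer_eqb (fst p) x then isotopic d (snd p) else false)
        (fronts [] d')
  end.

Definition first_some {A B : Type} (f : A -> option B) : list A -> option B :=
  fix go l :=
    match l with
    | [] => None
    | x :: l => match f x with Some y => Some y | None => go l end
    end.

(* [match_rest] and [match_all] look for an occurrence of a left-hand side up to
   interchange.  Nothing is proved about them: [apply_match] checks their result. *)
Fixpoint match_rest (n : nat) (done rest pre post d : diagram)
    : option (nat * diagram * diagram) :=
  match rest with
  | [] => Some (n, pre, post ++ d)
  | _ :: _ =>
    match d with
    | [] => None
    | x :: d' =>
        let taken :=
          match hd_error (to_front post x) with
          | Some (x', post') =>
              first_some (fun p : layer * diagram =>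
                let (y, rest') := p in
                if layer_eqb x' (n + fst y, snd y)
                then match_rest n (done ++ [y]) rest' pre post' d' else None)
                (fronts [] rest)
          | None => None
          end in
        match taken with
        | Some r => Some r
        | None =>
            match hd_error (to_front post x) with
            | None => match_rest n done rest pre (post ++ [x]) d'
            | Some (x', post') =>
                match hd_error (to_front (shift n done) x') with
                | None => match_rest n done rest pre (post ++ [x]) d'
                | Some (x'', s') =>
                    let n' := match s', done with
                              | (k, _) :: _, (o, _) :: _ => k - o
                              | _, _ => n
                              end in
                    match_rest n' done rest (pre ++ [x'']) post' d'
                end
            end
        end
    end
  end.

Fixpoint match_all (l pre d : diagram) : list (nat * diagram * diagram) :=
  match d with
  | [] => []
  | x :: d' =>
      let here :=
        first_some (fun p : layer * diagram =>
            let (y, rest') := p in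
            if (gen_eqb (snd x) (snd y)) && (fst y <=? fst x) then
              match_rest (fst x - fst y) [y] rest' pre [] d'
            else None)
          (fronts [] l) in
      match here with
      | Some r => r :: match_all l (pre ++ [x]) d'
      | None => match_all l (pre ++ [x]) d'
      end
  end.

(* source word, left-hand side, right-hand side *)
Definition rule : Type := list nat * diagram * diagram.

(** The second test compares the whole source word of the rule, including wires that [l] does not
    touch, because soundness of a rule is stated at that word. *)
Definition apply_match (w : list nat) (d : diagram) (r : rule)
    (mt : nat * diagram * diagram) : option diagram :=
  let '(s, l, l') := r in
  let '(n, pre, post) := mt in
  if isotopic (pre ++ shift n l ++ post) d then
    match run w pre with
    | Some w1 =>
        if (n <=? length w1) && word_eqb (firstn (length s) (skipn n w1)) s
        then Some (pre ++ shift n l' ++ post) else None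
    | None => None
    end
  else None.

Definition rewrite_rule (w : list nat) (r : rule) (d : diagram) : option diagram :=
  first_some (apply_match w d r) (match_all (snd (fst r)) [] d).

(** Earlier rules have priority. Every value of [fuel] gives an equal morphism; running out merely
    leaves a diagram that is not reduced. *)
Fixpoint normalize (fuel : nat) (w : list nat) (rs : list rule) (d : diagram) : diagram :=
  match fuel with
  | 0 => d
  | S fuel =>
      match first_some (fun r => rewrite_rule w r d) rs with
      | Some d' => normalize fuel w rs d'
      | None => d
      end
  end.

(* Cells with one input are moved before the crossings and the other ones after, so that
   normal forms are comultiplications and coactions, then crossings, then
   multiplications and actions.  For a crossing [r1] and [r2] are the two orientations
   of the Yang-Baxter equation, and without outputs the left-hand side of [r1] would
   have no crossing; both together, resp. [r1], would be applied for ever. *)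
Definition nat_rules_of (g : gen) (c : nat) : list rule :=
  let a := length (src g) in
  let r1 := (c :: src g, (1, g) :: cross_right c (tgt g) 0,
             cross_right c (src g) 0 ++ [(0, g)]) in
  let r2 := (src g ++ [c], (0, g) :: braid_words (tgt g) [c],
             braid_words (src g) [c] ++ [(1, g)]) in
  let inv (r : rule) : rule := let '(s, x, y) := r in (s, y, x) in
  match g with
  | Cross _ _ => [r1]
  | Cell _ =>
      if a =? 1 then [inv r1; inv r2] else
      match tgt g with [] => [] | _ => [r1; r2] end
  end.

Definition nat_rules (nw : nat) : list rule :=
  let ws := seq 0 nw in
  flat_map (fun n => flat_map (nat_rules_of (Cell n)) ws) (seq 0 (length ar))
  ++ flat_map (fun i => flat_map (fun j => flat_map (nat_rules_of (Cross i j)) ws) ws) ws.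

Fixpoint typ (e : expr) : option (list nat * list nat) :=
  match e with
  | EId o => Some (wires o, wires o)
  | ECell n => Some (src (Cell n), tgt (Cell n))
  | EBraid a b => Some (wires a ++ wires b, wires b ++ wires a)
  | EComp e f =>
      match typ e, typ f with
      | Some (s, t), Some (s', t') => if word_eqb t' s then Some (s', t) else None
      | _, _ => None
      end
  | ETens e f =>
      match typ e, typ f with
      | Some (s, t), Some (s', t') => Some (s ++ s', t ++ t')
      | _, _ => None
      end
  end.

Definition etgt e := match typ e with Some (_, t) => t | None => [] end.

(** In a tensor product the left factor is applied first, so the right one is shifted by the number
    of outputs of the left one. *)
Fixpoint flat (e : expr) : diagram :=
  match e with
  | EId o => []
  | ECell n => [(0, Cell n)]
  | EBraid a b => braid_words (wires a) (wires b)
  | EComp e f => flat f ++ flat e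
  | ETens e f => flat e ++ shift (length (etgt e)) (flat f)
  end.

End Syntax.

#[local] Arguments run : simpl never.
#[local] Arguments step : simpl never.

(** * Denotation of diagrams in a braided category *)

Section Semantics.
Context {C : braided_category}.
Variable obs : list (ob C).
Variable cells : list (oexpr * oexpr * mor C).

Notation I := (unit_ob C).

Definition wob (n : nat) : ob C := nth n obs I.

Fixpoint evo (o : oexpr) : ob C :=
  match o with
  | OUnit => I
  | OWire n => wob n
  | OTens a b => (evo a ⊗ evo b)%ob
  end.

Fixpoint word (w : list nat) : ob C :=
  match w with
  | [] => I
  | n :: w => (wob n ⊗ word w)%ob
  end.

Definition cell (n : nat) : oexpr * oexpr * mor C :=
  nth n cells (OUnit, OUnit, idm I).

Definition arity : list (list nat * list nat) :=
  map (fun c => (wires (fst (fst c)), wires (snd (fst c)))) cells.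

Definition gmor (g : gen) : mor C :=
  match g with
  | Cell n => snd (cell n)
  | Cross i j => Ψ (wob i) (wob j)
  end.

Fixpoint ev (e : expr) : mor C :=
  match e with
  | EId o => idm (evo o)
  | ECell n => snd (cell n)
  | EBraid a b => Ψ (evo a) (evo b)
  | EComp e f => ev e ∘ ev f
  | ETens e f => ev e ⊗ ev f
  end.

Definition well_typed : Prop :=
  Forall (fun c => hom (evo (fst (fst c))) (evo (snd (fst c))) (snd c)) cells.

Hypothesis cells_ok : well_typed.

Local Notation src := (src arity).
Local Notation tgt := (tgt arity).
Local Notation step := (step arity).
Local Notation run := (run arity).

Definition whisker (u : list nat) (f : mor C) (v : list nat) : mor C :=
  idm (word u) ⊗ f ⊗ idm (word v).

(** The value [idm I] on an ill-typed layer is junk; [run] singles out the diagrams whose denotation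
    is meaningful. *)
Fixpoint den (w : list nat) (d : diagram) : mor C :=
  match d with
  | [] => idm (word w)
  | (n, g) :: d =>
      match step w (n, g) with
      | Some w' =>
          den w' d ∘ whisker (firstn n w) (gmor g) (skipn (n + length (src g)) w)
      | None => idm I
      end
  end.

Lemma word_app u v : word (u ++ v) = (word u ⊗ word v)%ob.
Proof.
elim: u => [|n u IH] /=; first by rewrite tens_ob1l.
by rewrite IH tens_obA.
Qed.

Lemma evo_word o : evo o = word (wires o).
Proof.
elim: o => [|n|a IHa b IHb] //=; first by rewrite tens_ob1r.
by rewrite word_app IHa IHb.
Qed.

Lemma hom_gmor g : hom (word (src g)) (word (tgt g)) (gmor g).
Proof.
case: g => [n|i j] /=; last first.
  by rewrite !tens_ob1r; case: (braid_iso (wob i) (wob j)).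
(* The default arity is displayed as the arity of the default cell, so that [map_nth] applies. A
   cell number out of range then denotes the identity of [I], which has that arity. *)
rewrite /arity -[([], [])]/((fun c : oexpr * oexpr * mor C => (wires (fst (fst c)), wires (snd (fst c))))
   (OUnit, OUnit, idm I)) map_nth /= -!evo_word -/(cell n).
case: (Nat.lt_ge_cases n (length cells)) => Hn.
  by move/Forall_forall: cells_ok => H; apply: H; apply: nth_In.
by rewrite /cell nth_overflow //=; apply: hom_idm.
Qed.

Lemma hom_whisker u v s t f : hom (word s) (word t) f ->
  hom (word (u ++ s ++ v)) (word (u ++ t ++ v)) (whisker u f v).
Proof.
move=> Hf; rewrite !word_app !tens_obA.
by apply: hom_tens; [apply: hom_tens|]; rewrite //; apply: hom_idm.
Qed.

Lemma whisker_comp u v r s t f g :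
  hom (word r) (word s) f -> hom (word s) (word t) g ->
  whisker u (g ∘ f) v = whisker u g v ∘ whisker u f v.
Proof.
move=> Hf Hg; rewrite /whisker.
have Hu := hom_idm (word u); have Hv := hom_idm (word v).
rewrite -(tens_comp (hom_tens Hu Hf) (hom_tens Hu Hg) Hv Hv) (comp_idl Hv).
by rewrite -(tens_comp Hu Hu Hf Hg) (comp_idl Hu).
Qed.

Lemma whisker_app a u v b f :
  whisker (a ++ u) f (v ++ b) = whisker a (whisker u f v) b.
Proof. by rewrite /whisker !word_app -!tens_idm !tensA. Qed.

Lemma whisker_nil f : whisker [] f [] = f.
Proof. by rewrite /whisker /= tens_1l tens_1r. Qed.

Lemma whisker_idm u w v : whisker u (idm (word w)) v = idm (word (u ++ w ++ v)).
Proof. by rewrite /whisker !tens_idm !word_app tens_obA. Qed.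

Lemma run_cons u g v d :
  run (u ++ src g ++ v) ((length u, g) :: d) = run (u ++ tgt g ++ v) d.
Proof.
rewrite -[LHS]/(match step _ (_, _) with Some w' => run w' d | None => None end).
by rewrite step_word.
Qed.

Lemma den_cons u g v d :
  den (u ++ src g ++ v) ((length u, g) :: d) =
    den (u ++ tgt g ++ v) d ∘ whisker u (gmor g) v.
Proof.
rewrite [LHS]/den -/den step_word.
by case: (segment_word u (src g) v) => _ [-> ->].
Qed.

#[local] Arguments den : simpl never.

Lemma run_step w n g d w' : run w ((n, g) :: d) = Some w' ->
  exists u v, [/\ length u = n, w = u ++ src g ++ v & run (u ++ tgt g ++ v) d = Some w'].
Proof.
rewrite -[run _ _]/(match step w (n, g) with Some w' => run w' d | None => None end).
case E: (step _ _) => [w1|] // H.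
case: (step_spec E) => u [v [E1 E2 E3]].
by exists u, v; split => //; rewrite -E3.
Qed.

Lemma hom_den d w w' : run w d = Some w' -> hom (word w) (word w') (den w d).
Proof.
elim: d w => [|[n g] d IH] w; first by case=> <-; apply: hom_idm.
case/run_step => u [v [<- -> H]]; rewrite den_cons.
by apply: hom_comp (IH _ H); apply: hom_whisker; apply: hom_gmor.
Qed.

Lemma run_app d d' w w1 : run w d = Some w1 -> run w (d ++ d') = run w1 d'.
Proof.
elim: d w => [|[n g] d IH] w; first by case=> ->.
case/run_step => u [v [<- -> H]].
by rewrite -app_comm_cons run_cons IH.
Qed.

Lemma run_app_inv d d' w w2 : run w (d ++ d') = Some w2 ->
  exists w1, run w d = Some w1 /\ run w1 d' = Some w2.
Proof.
elim: d w => [|[n g] d IH] w; first by exists w.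
rewrite -app_comm_cons => /run_step [u [v [<- -> /IH [w1 [H1 H2]]]]].
by exists w1; rewrite run_cons.
Qed.

Lemma den_app d d' w w1 w2 : run w d = Some w1 -> run w1 d' = Some w2 ->
  den w (d ++ d') = den w1 d' ∘ den w d.
Proof.
elim: d w => [|[n g] d IH] w.
  by case=> -> /hom_den H /=; rewrite (comp_idr H).
case/run_step => u [v [<- -> H]] H'.
rewrite -app_comm_cons !den_cons (IH _ H H').
by rewrite (compA (hom_whisker u v (hom_gmor g)) (hom_den H) (hom_den H')).
Qed.

Definition eqv (w w' : list nat) (d d' : diagram) : Prop :=
  [/\ run w d = Some w', run w d' = Some w' & den w d = den w d'].

Lemma eqv_refl w w' d : run w d = Some w' -> eqv w w' d d.
Proof. by []. Qed.

Lemma eqv_sym w w' d d' : eqv w w' d d' -> eqv w w' d' d.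
Proof. by case=> *; split. Qed.

Lemma eqv_trans w w' d1 d2 d3 : eqv w w' d1 d2 -> eqv w w' d2 d3 -> eqv w w' d1 d3.
Proof. by move=> [H1 H2 E] [_ H3 E']; split=> //; rewrite E. Qed.

Lemma eqv_app w w1 w2 d d' e e' :
  eqv w w1 d d' -> eqv w1 w2 e e' -> eqv w w2 (d ++ e) (d' ++ e').
Proof.
case=> H1 H2 E [H3 H4 E']; split.
- by rewrite (run_app _ H1).
- by rewrite (run_app _ H2).
- by rewrite (den_app H1 H3) (den_app H2 H4) E E'.
Qed.

Lemma run_shift u v d s t : run s d = Some t ->
  run (u ++ s ++ v) (shift (length u) d) = Some (u ++ t ++ v).
Proof.
elim: d s => [|[n g] d IH] s; first by case=> ->.
case/run_step => a [b [<- -> /IH H]].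
have -> : u ++ (a ++ src g ++ b) ++ v = (u ++ a) ++ src g ++ (b ++ v) by rewrite -!app_assoc.
by rewrite /= -length_app run_cons -H -!app_assoc.
Qed.

Lemma den_shift u v d s t : run s d = Some t ->
  den (u ++ s ++ v) (shift (length u) d) = whisker u (den s d) v.
Proof.
elim: d s => [|[n g] d IH] s; first by case=> ->; rewrite whisker_idm.
case/run_step => a [b [<- -> H]].
have -> : u ++ (a ++ src g ++ b) ++ v = (u ++ a) ++ src g ++ (b ++ v) by rewrite -!app_assoc.
rewrite /= -length_app den_cons.
rewrite den_cons (whisker_comp _ _ (hom_whisker a b (hom_gmor g)) (hom_den H)) -(IH _ H).
by rewrite -whisker_app -!app_assoc.
Qed.

Lemma eqv_shift u v d d' s t : eqv s t d d' ->
  eqv (u ++ s ++ v) (u ++ t ++ v) (shift (length u) d) (shift (length u) d').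
Proof.
case=> H1 H2 E; split; try exact: run_shift.
by rewrite (den_shift _ _ H1) (den_shift _ _ H2) E.
Qed.

Lemma tens_exchange (A A' B B' : ob C) (f g : mor C) : hom A A' f -> hom B B' g ->
  (idm A' ⊗ g) ∘ (f ⊗ idm B) = (f ⊗ idm B') ∘ (idm A ⊗ g).
Proof.
move=> Hf Hg.
rewrite -(tens_comp Hf (hom_idm A') (hom_idm B) Hg).
rewrite -(tens_comp (hom_idm A) Hf Hg (hom_idm B')).
by rewrite (comp_idl Hf) (comp_idr Hf) (comp_idl Hg) (comp_idr Hg).
Qed.

Lemma interchange u g x h v :
  whisker (u ++ tgt g ++ x) (gmor h) v ∘ whisker u (gmor g) (x ++ src h ++ v) =
  whisker u (gmor g) (x ++ tgt h ++ v) ∘ whisker (u ++ src g ++ x) (gmor h) v.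
Proof.
have Hg := hom_whisker u x (hom_gmor g); have Hh := hom_whisker [] v (hom_gmor h).
have E y : whisker u (gmor g) (x ++ y) = whisker u (gmor g) x ⊗ idm (word y).
  by rewrite /whisker word_app -!tens_idm !tensA.
have E' y : whisker y (gmor h) v = idm (word y) ⊗ whisker [] (gmor h) v.
  by rewrite /whisker /= tens_1l tensA.
by rewrite !E (E' (u ++ tgt g ++ x)) (E' (u ++ src g ++ x)); apply: tens_exchange Hg Hh.
Qed.

Lemma den_left_right u g x h v (d := [(length u, g); (length (u ++ tgt g ++ x), h)]) :
  run (u ++ src g ++ x ++ src h ++ v) d = Some (u ++ tgt g ++ x ++ tgt h ++ v) /\
  den (u ++ src g ++ x ++ src h ++ v) d =
    whisker (u ++ tgt g ++ x) (gmor h) v ∘ whisker u (gmor g) (x ++ src h ++ v).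
Proof.
have E t : u ++ tgt g ++ x ++ t ++ v = (u ++ tgt g ++ x) ++ t ++ v by rewrite -!app_assoc.
rewrite /d run_cons den_cons !E run_cons den_cons; split=> //.
by rewrite (comp_idl (hom_whisker _ v (hom_gmor h))).
Qed.

Lemma den_right_left u g x h v (d := [(length (u ++ src g ++ x), h); (length u, g)]) :
  run (u ++ src g ++ x ++ src h ++ v) d = Some (u ++ tgt g ++ x ++ tgt h ++ v) /\
  den (u ++ src g ++ x ++ src h ++ v) d =
    whisker u (gmor g) (x ++ tgt h ++ v) ∘ whisker (u ++ src g ++ x) (gmor h) v.
Proof.
have E t : u ++ src g ++ x ++ t ++ v = (u ++ src g ++ x) ++ t ++ v by rewrite -!app_assoc.
rewrite /d E run_cons den_cons -E run_cons den_cons; split=> //.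
by rewrite (comp_idl (hom_whisker u _ (hom_gmor g))).
Qed.

Lemma swaps_eqv w w' x y x' y' : run w [x; y] = Some w' ->
  In (y', x') (swaps arity x y) -> eqv w w' [x; y] [y'; x'].
Proof.
case: x y => [n g] [m h].
case/run_step => u [v [<- -> /run_step [u2 [v2 [<- E H]]]]]; case: H => <-.
case/in_app_iff.
- case: Nat.leb_spec => [Hle|//]; case=> // -[<- <-].
  (* The outputs of [g] end before [h] begins; the [x] obtained next is the stretch of wires between
     them. *)
  have Hlen : length (u ++ tgt g) <= length u2 by rewrite length_app; lia.
  rewrite app_assoc in E; case: (app_eq_prefix E Hlen) => x [-> ->].
  have -> : length ((u ++ tgt g) ++ x) - length (tgt g) + length (src g)
      = length (u ++ src g ++ x) by rewrite !length_app; lia.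
  rewrite -!app_assoc.
  case: (den_left_right u g x h v2) => H1 H2.
  case: (den_right_left u g x h v2) => H3 H4.
  by split=> //; rewrite H2 H4 interchange.
- case: Nat.leb_spec => [Hle|//]; case=> // -[<- <-].
  have Hlen : length (u2 ++ src h) <= length u by rewrite length_app; lia.
  rewrite (app_assoc u2) in E; case: (app_eq_prefix (esym E) Hlen) => x [-> ->].
  have -> : length ((u2 ++ src h) ++ x) - length (src h) + length (tgt h)
      = length (u2 ++ tgt h ++ x) by rewrite !length_app; lia.
  rewrite -!app_assoc.
  case: (den_left_right u2 h x g v) => H1 H2.
  case: (den_right_left u2 h x g v) => H3 H4.
  by split=> //; rewrite H2 H4 interchange.
Qed.

Lemma to_front_eqv d y y' d' w w' : run w (d ++ [y]) = Some w' ->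
  In (y', d') (to_front arity d y) -> eqv w w' (d ++ [y]) (y' :: d').
Proof.
elim: d w y' d' => [|x d IH] w y' d'; first by move=> H [[<- <-]|//]; apply: eqv_refl.
move=> H /in_flat_map [[y1 d1] [Hin /in_map_iff [[y2 x1] /= [[<- <-] Hs]]]].
have [w1 [H1 H2]] := run_app_inv (d := [x]) H.
have V := IH _ _ _ H2 Hin.
have W : eqv w w' ([x] ++ d ++ [y]) ([x] ++ y1 :: d1).
  by apply: eqv_app V; apply: eqv_refl.
apply: eqv_trans (W) _; rewrite -[[x] ++ _]/([x; y1] ++ d1) -[y2 :: _]/([y2; x1] ++ d1).
case: W => _ W _.
case/(run_app_inv (d := [x; y1])): W => w2 [H3 H4].
by apply: eqv_app (eqv_refl H4); apply: swaps_eqv Hs.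
Qed.

Lemma fronts_eqv x acc d d' w w' : run w (acc ++ d) = Some w' ->
  In (x, d') (fronts arity acc d) -> eqv w w' (acc ++ d) (x :: d').
Proof.
elim: d acc => [|y d IH] acc //= H.
have E0 : acc ++ y :: d = (acc ++ [y]) ++ d by rewrite -app_assoc.
rewrite E0 in H *.
case/in_app_iff; last exact: IH.
case/in_map_iff => -[y' acc'] /= [[<- <-] Hin].
have [w1 [H1 H2]] := run_app_inv H.
by apply: (eqv_app (e := d) (e' := d) (to_front_eqv H1 Hin)); apply: eqv_refl.
Qed.

Lemma isotopic_eqv d d' w w' : run w d' = Some w' ->
  isotopic arity d d' = true -> eqv w w' d d'.
Proof.
elim: d d' w => [|x d IH] d' w H /=; first by case: d' H => // H _; apply: eqv_refl.
case/any_exists => -[y d1] Hin /=; case Ey: (layer_eqb _ _) => // Hi.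
rewrite (layer_eqb_eq Ey) in Hin.
have V := fronts_eqv (acc := []) H Hin.
apply: eqv_trans (eqv_sym V).
case: V => _ H1 _.
have [w1 [H2 H3]] := run_app_inv (d := [x]) H1.
by apply: (eqv_app (d := [x]) (d' := [x]) _ (IH _ _ H3 Hi)); apply: eqv_refl.
Qed.

Definition sound (r : rule) : Prop :=
  let '(s, l, l') := r in exists t, eqv s t l l'.

Lemma apply_match_eqv w w' d d' r m : sound r -> run w d = Some w' ->
  apply_match arity w d r m = Some d' -> eqv w w' d d'.
Proof.
case: r m => [[s l] l'] [[n pre] post] /= [t Ht] Hd.
case Hi: (isotopic _ _ _) => //.
have V := isotopic_eqv Hd Hi.
case: (V) => H1 _ _; case/run_app_inv: H1 => w1 [H1 H2].
rewrite H1; case Hseg: (_ && _) => // -[<-].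
case: (word_segment Hseg) => E1 E2.
apply: eqv_trans (eqv_sym V) _.
apply: eqv_app (eqv_refl H1) _.
case/run_app_inv: H2 => w2 [H2 H3].
have := eqv_shift (firstn n w1) (skipn (n + length s) w1) Ht.
rewrite -E1 E2 => W.
have E : w2 = firstn n w1 ++ t ++ skipn (n + length s) w1.
  by case: W; rewrite H2 => -[].
rewrite -E in W.
by apply: eqv_app W (eqv_refl H3).
Qed.

Lemma first_someP A B (f : A -> option B) l y :
  first_some f l = Some y -> exists2 x, In x l & f x = Some y.
Proof.
elim: l => //= x l IH; case E: (f x) => [z|].
  by move=> [<-]; exists x => //; left.
by case/IH => x' H1 H2; exists x' => //; right.
Qed.

Lemma normalize_eqv fuel w w' rs d : Forall sound rs -> run w d = Some w' ->
  eqv w w' d (normalize arity fuel w rs d).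
Proof.
move=> Hrs; elim: fuel d => [|fuel IH] d Hd /=; first exact: eqv_refl.
case E: (first_some _ _) => [d'|]; last exact: eqv_refl.
have [r Hr Er] := first_someP E; have [m _ Hm] := first_someP Er.
have V := apply_match_eqv (proj1 (Forall_forall _ _) Hrs r Hr) Hd Hm.
apply: eqv_trans (V) _; apply: IH; by case: V.
Qed.

(** * Coherence of the braiding and soundness of the rules *)

Lemma braid_unit_idl (A : ob C) : Ψ I A = idm A.
Proof.
have := braid_tensl I I A.
rewrite tens_ob1l tens_1l tens_1r => E.
case: (braid_iso I A); rewrite tens_ob1l tens_ob1r => H [g [Hg [E1 E2]]].
(* [E] makes the braiding equal to its own square, and an invertible idempotent is an identity. *)
by rewrite -{1}(comp_idl H) -{1}E1 -(compA H H Hg) -E E1.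
Qed.

Lemma braid_unit_idr (A : ob C) : Ψ A I = idm A.
Proof.
have := braid_tensr A I I.
rewrite tens_ob1l tens_1l tens_1r => E.
case: (braid_iso A I); rewrite tens_ob1l tens_ob1r => H [g [Hg [E1 E2]]].
by rewrite -{1}(comp_idl H) -{1}E1 -(compA H H Hg) -E E1.
Qed.

(** Induction with [braid_tensr]; the prefix [u] is general because the recursive call starts one
    wire further right. *)
Lemma cross_right_spec c ws u :
  run (u ++ c :: ws) (cross_right c ws (length u)) = Some (u ++ ws ++ [c]) /\
  den (u ++ c :: ws) (cross_right c ws (length u)) =
    idm (word u) ⊗ Ψ (wob c) (word ws).
Proof.
elim: ws u => [|w ws IH] u /=.
  split=> //; rewrite braid_unit_idr tens_idm.
  by rewrite -[den _ _]/(idm (word (u ++ [c]))) word_app /= tens_ob1r.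
have [H1 H2] := IH (u ++ [w]).
rewrite length_app /= Nat.add_1_r -!app_assoc /= in H1 H2.
have E1 := run_cons u (Cross c w) ws (cross_right c ws (S (length u))).
have E2 := den_cons u (Cross c w) ws (cross_right c ws (S (length u))).
rewrite /= in E1 E2.
rewrite E1 E2 H1 H2; split=> //.
rewrite /whisker braid_tensr word_app /= tens_ob1r -tens_idm -!tensA.
case: (braid_iso (wob c) (wob w)) => Hw _.
case: (braid_iso (wob c) (word ws)) => Hws _.
have H3 := hom_tens (hom_idm (wob w)) Hws.
have H4 := hom_tens Hw (hom_idm (word ws)).
rewrite -!tens_obA in H4.
by rewrite -(tens_comp (hom_idm (word u)) (hom_idm (word u)) H4 H3) (comp_idl (hom_idm _)).
Qed.

Lemma braid_words_spec a b :
  run (a ++ b) (braid_words a b) = Some (b ++ a) /\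
  den (a ++ b) (braid_words a b) = Ψ (word a) (word b).
Proof.
elim: a => [|c a [IH1 IH2]] /=.
  by rewrite app_nil_r braid_unit_idl.
have R := run_shift [c] [] IH1; have E := den_shift [c] [] IH1.
rewrite /= !app_nil_r in R E.
case: (cross_right_spec c b []) => H1 H2.
have R2 := run_shift [] a H1; have E2 := den_shift [] a H1.
rewrite /= shift0 -!app_assoc /= in R2 E2.
rewrite (run_app _ R) R2 (den_app R R2) E E2 IH2 H2 braid_tensl /whisker /=.
by rewrite !tens_1l !tens_ob1r tens_1r.
Qed.

Lemma den_cell g : run (src g) [(0, g)] = Some (tgt g) /\ den (src g) [(0, g)] = gmor g.
Proof.
have E1 := run_cons [] g [] []; have E2 := den_cons [] g [] [].
rewrite /= !app_nil_r in E1 E2.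
split=> //; rewrite [LHS]E2 whisker_nil; exact: (comp_idl (hom_gmor g)).
Qed.

Lemma nat_left g c :
  eqv (c :: src g) (tgt g ++ [c]) ((1, g) :: cross_right c (tgt g) 0)
    (cross_right c (src g) 0 ++ [(0, g)]).
Proof.
have E1 := run_cons [c] g [] (cross_right c (tgt g) 0).
have E2 := den_cons [c] g [] (cross_right c (tgt g) 0).
case: (cross_right_spec c (tgt g) []) => H1 H2.
case: (cross_right_spec c (src g) []) => H3 H4.
have [H5 H6] := den_cell g.
have R := run_shift [] [c] H5; have E := den_shift [] [c] H5.
rewrite /= !app_nil_r /= in E1 E2 H1 H2 H3 H4 R E.
split.
- by rewrite E1.
- by rewrite (run_app _ H3).
- rewrite [LHS]E2 (den_app H3 R) H2 H4 [in RHS]E H6 /whisker /= !tens_1l tens_1r !tens_ob1r.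
  by apply: braid_natural (hom_idm _) (hom_gmor g).
Qed.

Lemma nat_right g c :
  eqv (src g ++ [c]) (c :: tgt g) ((0, g) :: braid_words (tgt g) [c])
    (braid_words (src g) [c] ++ [(1, g)]).
Proof.
have E1 := run_cons [] g [c] (braid_words (tgt g) [c]).
have E2 := den_cons [] g [c] (braid_words (tgt g) [c]).
case: (braid_words_spec (tgt g) [c]) => H1 H2.
case: (braid_words_spec (src g) [c]) => H3 H4.
have [H5 H6] := den_cell g.
have R := run_shift [c] [] H5; have E := den_shift [c] [] H5.
rewrite /= !app_nil_r /= in E1 E2 H1 H2 H3 H4 R E.
split.
- by rewrite E1.
- by rewrite (run_app _ H3).
- rewrite [LHS]E2 (den_app H3 R) H2 H4 [in RHS]E H6 /whisker /= !tens_1l tens_1r !tens_ob1r.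
  by apply: braid_natural (hom_gmor g) (hom_idm _).
Qed.

Lemma nat_rules_of_sound g c : Forall sound (nat_rules_of arity g c).
Proof.
rewrite /nat_rules_of.
have R1 : sound (c :: src g, (1, g) :: cross_right c (tgt g) 0, cross_right c (src g) 0 ++ [(0, g)]).
  by exists (tgt g ++ [c]); apply: nat_left.
have R2 : sound (src g ++ [c], (0, g) :: braid_words (tgt g) [c], braid_words (src g) [c] ++ [(1, g)]).
  by exists (c :: tgt g); apply: nat_right.
have inv s l l' : sound (s, l, l') -> sound (s, l', l).
  by case=> t /eqv_sym H; exists t.
case: g R1 R2 => [n|i j] R1 R2; last by repeat constructor.
case: (_ =? _); first by repeat constructor; apply: inv.
by case: (tgt (Cell n)) R1 R2 => [|i t] R1 R2; repeat constructor.
Qed.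

Lemma nat_rules_sound nw : Forall sound (nat_rules arity nw).
Proof.
apply/Forall_app; split; apply/Forall_flat_map/Forall_forall => i _;
  apply/Forall_flat_map/Forall_forall => j _.
  exact: nat_rules_of_sound.
by apply/Forall_flat_map/Forall_forall => k _; apply: nat_rules_of_sound.
Qed.

Lemma flat_spec e s t : typ arity e = Some (s, t) ->
  run s (flat arity e) = Some t /\ den s (flat arity e) = ev e.
Proof.
elim: e s t => [o|n|a b|e IHe f IHf|e IHe f IHf] s t /=.
- by case=> <- <-; rewrite evo_word.
- by case=> <- <-; apply: (den_cell (Cell n)).
- by case=> <- <-; rewrite !evo_word; apply: braid_words_spec.
- case: (typ _ e) IHe => [[s1 t1]|] // IHe.
  case: (typ _ f) IHf => [[s2 t2]|] // IHf.
  case E: (word_eqb _ _) => // -[<- <-].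
  have [H1 H2] := IHe _ _ erefl; have [H3 H4] := IHf _ _ erefl.
  rewrite -(word_eqb_eq E) in H1 H2.
  by rewrite (run_app _ H3) (den_app H3 H1) H2 H4.
- case E1: (typ _ e) IHe => [[s1 t1]|] // IHe.
  case: (typ _ f) IHf => [[s2 t2]|] // IHf.
  case=> <- <-; rewrite /etgt E1.
  have [H1 H2] := IHe _ _ erefl; have [H3 H4] := IHf _ _ erefl.
  have R1 := run_shift [] s2 H1; have D1 := den_shift [] s2 H1.
  have R2 := run_shift t1 [] H3; have D2 := den_shift t1 [] H3.
  rewrite /= shift0 in R1 D1; rewrite /= !app_nil_r in R2 D2.
  rewrite (run_app _ R1) R2 (den_app R1 R2) D1 D2; split=> //.
  rewrite /whisker /= tens_1l tens_1r.
  have K1 := hom_den H1; have K2 := hom_den H3.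
  by rewrite -(tens_comp K1 (hom_idm _) (hom_idm _) K2) (comp_idl K1) (comp_idr K2) H2 H4.
Qed.

(** The left side is put in normal form for naturality, since it has to be found inside diagrams on
    which the naturality rules also act. The fuel 1000 is just a generous bound. *)
Definition to_rule (p : expr * expr) : list rule :=
  match typ arity (fst p), typ arity (snd p) with
  | Some (s, t), Some (s', t') =>
      if word_eqb s s' && word_eqb t t'
      then
        let l := normalize arity 1000 s (nat_rules arity (length obs)) (flat arity (fst p)) in
        [(s, l, flat arity (snd p))]
      else []
  | _, _ => []
  end.

Definition ev_sides (p : expr * expr) : mor C * mor C := (ev (fst p), ev (snd p)).

Lemma to_rule_sound p : ev (fst p) = ev (snd p) -> Forall sound (to_rule p).
Proof.
case: p => l r /= E; rewrite /to_rule /=.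
case El: (typ _ l) => [[s t]|] //; case Er: (typ _ r) => [[s' t']|] //.
case H: (_ && _) => //; case/andb_prop: H => /word_eqb_eq Hs /word_eqb_eq Ht.
rewrite -Hs -Ht in Er.
have [H1 H2] := flat_spec El; have [H3 H4] := flat_spec Er.
have [_ H5 H6] := normalize_eqv 1000 (nat_rules_sound (length obs)) H1.
by repeat constructor; exists t; split; rewrite // -H6 H2 H4.
Qed.

Record equation := Equation {
  eq_lhs : mor C;
  eq_rhs : mor C;
  eq_pf : eq_lhs = eq_rhs
}.

Definition rules (l : list (expr * expr)) : list rule :=
  flat_map to_rule l ++ nat_rules arity (length obs).

Definition reified (l : list (expr * expr)) (q : list equation) : Prop :=
  map ev_sides l = map (fun x => (eq_lhs x, eq_rhs x)) q.

(** Each side has its own rules: often an axiom must be expanded on one side only, while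
    associativity has to normalise both. *)
Definition check (l l' : list (expr * expr)) (e e' : expr) : bool :=
  match typ arity e, typ arity e' with
  | Some (s, t), Some (s', t') =>
      word_eqb s s' && word_eqb t t' &&
      isotopic arity (normalize arity 1000 s (rules l) (flat arity e))
        (normalize arity 1000 s' (rules l') (flat arity e'))
  | _, _ => false
  end.

Lemma rules_sound l q : reified l q -> Forall sound (rules l).
Proof.
move=> Hl; apply/Forall_app; split; last exact: nat_rules_sound.
apply/Forall_flat_map/Forall_forall => p Hp; apply: to_rule_sound.
have := in_map ev_sides _ _ Hp; rewrite Hl => /in_map_iff [x [E _]].
by case: E; rewrite (eq_pf x) => -> ->.
Qed.

Lemma string_hom a b e : typ arity e = Some (wires a, wires b) ->
  hom (evo a) (evo b) (ev e).
Proof. by case/flat_spec => /hom_den H <-; rewrite !evo_word. Qed.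

Theorem string_equation l q l' q' e e' :
  reified l q -> reified l' q' -> check l l' e e' = true -> ev e = ev e'.
Proof.
move=> /rules_sound H /rules_sound H'; rewrite /check.
case E: (typ _ e) => [[s t]|] //; case E': (typ _ e') => [[s' t']|] //.
case/andb_prop => /andb_prop [/word_eqb_eq Hs /word_eqb_eq Ht] Hi.
rewrite -Hs -Ht in E' Hi.
have [H1 <-] := flat_spec E; have [H2 <-] := flat_spec E'.
have V := normalize_eqv 1000 H H1; have V' := normalize_eqv 1000 H' H2.
have [_ H3 _] := V'.
have [_ _ ->] := eqv_trans V (isotopic_eqv H3 Hi).
by case: V'.
Qed.

End Semantics.

(** * Reification of goals and equations *)

Arguments Equation {C eq_lhs eq_rhs} eq_pf.

Notation "'eqns[' a ; .. ; b ]" := (cons (Equation a) .. (cons (Equation b) nil) ..).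

Record signature (C : braided_category) := Signature {
  sig_obs : list (ob C);
  sig_cells : list (oexpr * oexpr * mor C);
  sig_typed : well_typed sig_obs sig_cells
}.

Ltac find_ob A obs :=
  lazymatch obs with
  | A :: _ => constr:(0)
  | _ :: ?obs' => let n := find_ob A obs' in constr:(S n)
  | _ => fail "unknown object" A
  end.

Ltac reify_ob obs A :=
  lazymatch A with
  | unit_ob _ => constr:(OUnit)
  | tens_ob ?X ?Y =>
      let x := reify_ob obs X in let y := reify_ob obs Y in constr:(OTens x y)
  | _ => let n := find_ob A obs in constr:(OWire n)
  end.

Ltac find_cell f cells :=
  lazymatch cells with
  | (_, f) :: _ => constr:(0)
  | _ :: ?cells' => let n := find_cell f cells' in constr:(S n)
  | _ => fail "unknown morphism" f
  end.

Ltac reify obs cells f :=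
  lazymatch f with
  | comp ?g ?h =>
      let x := reify obs cells g in let y := reify obs cells h in constr:(EComp x y)
  | tens ?g ?h =>
      let x := reify obs cells g in let y := reify obs cells h in constr:(ETens x y)
  | idm ?A => let o := reify_ob obs A in constr:(EId o)
  | Ψ ?A ?B => let a := reify_ob obs A in let b := reify_ob obs B in constr:(EBraid a b)
  | _ => let n := find_cell f cells in constr:(ECell n)
  end.

Ltac string_simpl t :=
  let t := eval cbv beta iota delta [
    cross_product tensor_product phi12 phi21 biproduct_phi12 biproduct_phi21 smash_phi21
    diag_left_action diag_right_action diag_left_coaction diag_right_coaction crossed_braid
    mu_l_trivial mu_r_trivial nu_l_trivial nu_r_trivial] in t in
  eval cbn beta iota delta [mult unit comult counit carrier] in t.

Ltac reify_equation obs cells H :=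
  let T := type of H in
  let T := string_simpl T in
  lazymatch T with
  | ?l = ?r =>
      let x := reify obs cells l in let y := reify obs cells r in constr:((x, y))
  end.

Ltac reify_equations obs cells l :=
  lazymatch l with
  | nil => constr:(@nil (expr * expr))
  | @Equation _ _ _ ?H :: ?l' =>
      let x := reify_equation obs cells H in
      let y := reify_equations obs cells l' in constr:(x :: y)
  | _ => let l := eval hnf in l in reify_equations obs cells l
  end.

(* Proves [f = g] by rewriting [f] with the equations [L], [g] with the equations
   [L'], both with naturality of the braiding, until they are isotopic diagrams. *)
Ltac string_tac S L L' :=
  let obs := eval hnf in (sig_obs S) in
  let cells := eval hnf in (sig_cells S) in
  lazymatch goal with
  | |- ?f = ?g =>
      let f := string_simpl f in let g := string_simpl g in
      let e := reify obs cells f in let e' := reify obs cells g in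
      let l := reify_equations obs cells L in let l' := reify_equations obs cells L' in
      (* The two [eq_refl] check by conversion that the reified equations evaluate to the given
         ones; this also unfolds [phi12] and similar definitions. *)
      refine (@string_equation _ obs cells (sig_typed S) l L l' L' e e' eq_refl eq_refl _);
      vm_compute; exact eq_refl
  end.

Tactic Notation "string" constr(S) open_constr(L) open_constr(L') := string_tac S L L'.

(* The goal is joined to [H] at both ends: [L] identifies the left sides with each other, and
   likewise the right sides, while [H] is the step between them. *)
Tactic Notation "string_from" constr(H) constr(S) open_constr(L) :=
  refine (etrans _ (etrans H _)); [string S L L | string S L L].

Ltac string_typed S :=
  let obs := eval hnf in (sig_obs S) in
  let cells := eval hnf in (sig_cells S) in
  lazymatch goal with
  | |- hom ?A ?B ?f =>
      let A := string_simpl A in let B := string_simpl B in let f := string_simpl f in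
      let a := reify_ob obs A in let b := reify_ob obs B in let e := reify obs cells f in
      exact (@string_hom _ obs cells (sig_typed S) a b e eq_refl)
  end.

(** * Hopf data and their equivalent descriptions *)

Section TrivialActions.
Context {C : braided_category}.
Variables (H A : bialg_data C).
Hypotheses (Ha : is_algebra H) (Hc : is_coalgebra H).
Hypotheses (Aa : is_algebra A) (Ac : is_coalgebra A).

Definition pair_cells : list (oexpr * oexpr * mor C) :=
  let w1 := OWire 0 in let w2 := OWire 1 in
  [(OTens w1 w1, w1, mult H); (OUnit, w1, unit H);
   (w1, OTens w1 w1, comult H); (w1, OUnit, counit H);
   (OTens w2 w2, w2, mult A); (OUnit, w2, unit A);
   (w2, OTens w2 w2, comult A); (w2, OUnit, counit A)].

Lemma pair_well_typed : well_typed [H : ob C; A : ob C] pair_cells.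
Proof.
case: Ha Hc Aa Ac => ? ? _ _ _ [? ? _ _ _] [? ? _ _ _] [? ? _ _ _].
by repeat (apply: Forall_cons; first done).
Qed.

Definition pair_signature : signature C := Signature pair_well_typed.

Lemma trivial_left_module : counit_algebra_morphism H ->
  is_left_module H A (counit H ⊗ idm A).
Proof.
case=> E1 E2; split.
- by rewrite -[X in hom _ X _]tens_ob1l; apply: hom_tens (counit_hom Hc) (hom_idm A).
- string pair_signature eqns[E1] eqns[E1].
- string pair_signature eqns[E2] eqns[E2].
Qed.

Lemma trivial_right_module : counit_algebra_morphism H ->
  is_right_module H A (idm A ⊗ counit H).
Proof.
case=> E1 E2; split.
- by rewrite -[X in hom _ X _]tens_ob1r; apply: hom_tens (hom_idm A) (counit_hom Hc).
- string pair_signature eqns[E1] eqns[E1].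
- string pair_signature eqns[E2] eqns[E2].
Qed.

Lemma trivial_left_comodule : unit_coalgebra_morphism H ->
  is_left_comodule H A (unit H ⊗ idm A).
Proof.
case=> E1 E2; split.
- by rewrite -[X in hom X _ _]tens_ob1l; apply: hom_tens (unit_hom Ha) (hom_idm A).
- string pair_signature eqns[E1] eqns[E1].
- string pair_signature eqns[E2] eqns[E2].
Qed.

Lemma trivial_right_comodule : unit_coalgebra_morphism H ->
  is_right_comodule H A (idm A ⊗ unit H).
Proof.
case=> E1 E2; split.
- by rewrite -[X in hom X _ _]tens_ob1r; apply: hom_tens (hom_idm A) (unit_hom Ha).
- string pair_signature eqns[E1] eqns[E1].
- string pair_signature eqns[E2] eqns[E2].
Qed.

End TrivialActions.

(** These are the axioms without the long compatibility identities. They type all cells and carry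
    the unit and counit rules, so they are extracted from each description before anything else can
    be rewritten. *)
Record hopf_units {C : braided_category} (D : hopf_data C) : Prop := {
  hu_algebra1 : is_algebra (B1 D);
  hu_coalgebra1 : is_coalgebra (B1 D);
  hu_counit1 : counit_algebra_morphism (B1 D);
  hu_unit1 : unit_coalgebra_morphism (B1 D);
  hu_algebra2 : is_algebra (B2 D);
  hu_coalgebra2 : is_coalgebra (B2 D);
  hu_counit2 : counit_algebra_morphism (B2 D);
  hu_unit2 : unit_coalgebra_morphism (B2 D);
  hu_lmodule : is_left_module (B2 D) (B1 D) (mu_l D);
  hu_lcomodule : is_left_comodule (B2 D) (B1 D) (nu_l D);
  hu_rmodule : is_right_module (B1 D) (B2 D) (mu_r D);
  hu_rcomodule : is_right_comodule (B1 D) (B2 D) (nu_r D);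
  hu_mur_unit : mu_r D ∘ (unit (B2 D) ⊗ idm (B1 D)) = unit (B2 D) ∘ counit (B1 D);
  hu_nul_counit : (idm (B2 D) ⊗ counit (B1 D)) ∘ nu_l D = unit (B2 D) ∘ counit (B1 D);
  hu_counit_mur : counit (B2 D) ∘ mu_r D = counit (B2 D) ⊗ counit (B1 D);
  hu_counit_mul : counit (B1 D) ∘ mu_l D = counit (B2 D) ⊗ counit (B1 D);
  hu_mul_unit : mu_l D ∘ (idm (B2 D) ⊗ unit (B1 D)) = unit (B1 D) ∘ counit (B2 D);
  hu_nur_counit : (counit (B2 D) ⊗ idm (B1 D)) ∘ nu_r D = unit (B1 D) ∘ counit (B2 D);
  hu_nur_unit : nu_r D ∘ unit (B2 D) = unit (B2 D) ⊗ unit (B1 D);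
  hu_nul_unit : nu_l D ∘ unit (B1 D) = unit (B2 D) ⊗ unit (B1 D)
}.

Section HopfUnits.
Context {C : braided_category} (D : hopf_data C).

Definition hopf_cells : list (oexpr * oexpr * mor C) :=
  let w1 := OWire 0 in let w2 := OWire 1 in
  [(OTens w1 w1, w1, mult (B1 D)); (OUnit, w1, unit (B1 D));
   (w1, OTens w1 w1, comult (B1 D)); (w1, OUnit, counit (B1 D));
   (OTens w2 w2, w2, mult (B2 D)); (OUnit, w2, unit (B2 D));
   (w2, OTens w2 w2, comult (B2 D)); (w2, OUnit, counit (B2 D));
   (OTens w2 w1, w1, mu_l D); (w1, OTens w2 w1, nu_l D);
   (OTens w2 w1, w2, mu_r D); (w2, OTens w2 w1, nu_r D)].

Lemma hopf_datum_units : is_hopf_datum D -> hopf_units D.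
Proof. by case; split. Qed.

Lemma hopf_well_typed : hopf_units D -> well_typed [B1 D : ob C; B2 D : ob C] hopf_cells.
Proof.
case=> a1 c1 _ _ a2 c2 _ _ ml nl mr nr *.
case: a1 => ? ? _ _ _; case: a2 => ? ? _ _ _; case: c1 => ? ? _ _ _; case: c2 => ? ? _ _ _.
case: ml => ? _ _; case: nl => ? _ _; case: mr => ? _ _; case: nr => ? _ _.
by repeat (apply: Forall_cons; first done).
Qed.

Variable U : hopf_units D.

Definition hopf_signature : signature C := Signature (hopf_well_typed U).

Definition unit_equations : list equation :=
  eqns[mult_unitl (hu_algebra1 U); mult_unitr (hu_algebra1 U);
   mult_unitl (hu_algebra2 U); mult_unitr (hu_algebra2 U);
   comult_counitl (hu_coalgebra1 U); comult_counitr (hu_coalgebra1 U);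
   comult_counitl (hu_coalgebra2 U); comult_counitr (hu_coalgebra2 U);
   proj1 (hu_counit1 U); proj2 (hu_counit1 U); proj1 (hu_unit1 U);
   proj1 (hu_counit2 U); proj2 (hu_counit2 U); proj1 (hu_unit2 U);
   lmod_unit (hu_lmodule U); lcomod_counit (hu_lcomodule U);
   rmod_unit (hu_rmodule U); rcomod_counit (hu_rcomodule U);
   hu_mur_unit U; hu_nul_counit U; hu_counit_mur U;
   hu_counit_mul U; hu_mul_unit U; hu_nur_counit U;
   hu_nur_unit U; hu_nul_unit U].

End HopfUnits.

Tactic Notation "units" constr(U) constr(T) :=
  string (hopf_signature U) (T ++ unit_equations U) (T ++ unit_equations U).

Tactic Notation "units_from" constr(U) constr(T) constr(H) :=
  string_from H (hopf_signature U) (T ++ unit_equations U).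

Section TrivialMuL.
Context {C : braided_category} (D : hopf_data C).
Hypothesis T : mu_l_trivial D.
Local Notation TE := eqns[T].

Lemma mu_l_trivial_datum_units : is_mu_l_trivial_datum D -> hopf_units D.
Proof.
case=> [[a1 c1 _ e1 u1]] lc1 a2 e2 [rm _ [_ _] [_ mur_unit]] [rc _ [_ _] [_ nur_unit]] c2 u2.
move=> counit_mur nul_unit nur_counit nul_counit *.
split=> //; rewrite ?T.
- exact: trivial_left_module.
- string (pair_signature a1 c1 a2 c2) [] [].
- string (pair_signature a1 c1 a2 c2) [] [].
(* [pair_signature] has no cell for a (co)action, so [ν_r] is eliminated before reification. *)
- rewrite nur_unit; string (pair_signature a1 c1 a2 c2) [] [].
Qed.

Lemma hopf_datum_mu_l_trivial : is_hopf_datum D <-> is_mu_l_trivial_datum D.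
Proof.
split=> [h|h].
- have U := hopf_datum_units h.
  case: (U) => a1 c1 e1 u1 a2 c2 e2 u2 lm lc rm rc *.
  split=> //.
  + by split=> //; units_from U TE (hd_algebra_coalgebra1 h).
  + split=> //; split=> //.
    * exact: mult_hom a2.
    * units_from U TE (esym (hd_module_algebra_r h)).
    * exact: unit_hom a2.
  + split=> //; split=> //.
    * exact: mult_hom a2.
    * units_from U TE (hd_comodule_algebra_r h).
    * exact: unit_hom a2.
    * units U TE.
  + exact: hd_algebra_coalgebra2 h.
  + units_from U TE (hd_module_comodule h).
  + exact: hd_comodule_coalgebra_r h.
  + exact: hd_comodule_coalgebra_l h.
  + exact: hd_module_coalgebra_r h.
  + exact: hd_comodule_algebra_l h.
- have U := mu_l_trivial_datum_units h.
  case: (U) => *; split=> //.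
  + units_from U TE (bialg_compat (lt_bialgebra1 h)).
  + exact: lt_algebra_coalgebra2 h.
  + units_from U TE (lt_compat h).
  + units_from U TE (esym (proj2 (rma_mult (lt_module_algebra2 h)))).
  (* This is [hd_module_algebra_l]: for the trivial [μl] both sides reduce to counits next to
     [m1]. *)
  + units U TE.
  + exact: lt_comult_nur h.
  + exact: lt_comult_nul h.
  + exact: lt_comult_mur h.
  + units U TE.
  + units_from U TE (proj2 (rca_mult (lt_comodule_algebra2 h))).
  + exact: lt_nul_mult h.
Qed.
End TrivialMuL.

Section Bicross.
Context {C : braided_category} (D : hopf_data C).
Hypotheses (T : mu_l_trivial D) (N : nu_r_trivial D).
Local Notation TE := eqns[T; N].

Lemma bicross_datum_units : is_bicross_datum D -> hopf_units D.
Proof.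
case=> -[a1 c1 _ e1 u1] [a2 c2 _ e2 u2] [lc _ _ [_ nul_counit]] [rm _ _ [_ mur_unit]].
move=> counit_mur nul_unit *.
split=> //; rewrite ?T ?N.
- exact: trivial_left_module.
- exact: trivial_right_comodule.
- string (pair_signature a1 c1 a2 c2) [] [].
- string (pair_signature a1 c1 a2 c2) [] [].
- string (pair_signature a1 c1 a2 c2) [] [].
- string (pair_signature a1 c1 a2 c2) [] [].
Qed.

Lemma hopf_datum_bicross : is_hopf_datum D <-> is_bicross_datum D.
Proof.
split=> h.
- have U := hopf_datum_units h.
  case: (U) => a1 c1 e1 u1 a2 c2 e2 u2 lm lc rm rc *.
  split=> //.
  + by split=> //; units_from U TE (hd_algebra_coalgebra1 h).
  + by split=> //; units_from U TE (hd_algebra_coalgebra2 h).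
  + split=> //; split=> //.
    * exact: comult_hom c1.
    * units_from U TE (esym (hd_comodule_coalgebra_l h)).
    * exact: counit_hom c1.
  + split=> //; split=> //.
    * exact: mult_hom a2.
    * units_from U TE (esym (hd_module_algebra_r h)).
    * exact: unit_hom a2.
  + units_from U TE (hd_module_comodule h).
  + exact: hd_module_coalgebra_r h.
  + exact: hd_comodule_algebra_l h.
- have U := bicross_datum_units h.
  case: (U) => *; split=> //.
  + units_from U TE (bialg_compat (bc_bialgebra1 h)).
  + units_from U TE (bialg_compat (bc_bialgebra2 h)).
  + units_from U TE (bc_compat h).
  + units_from U TE (esym (proj2 (rma_mult (bc_module_algebra h)))).
  + units U TE.
  + units U TE.
  + units_from U TE (esym (proj2 (lcc_comult (bc_comodule_coalgebra h)))).
  + exact: bc_comult_mur h.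
  + units U TE.
  + units U TE.
  + exact: bc_nul_mult h.
Qed.
End Bicross.

Section MatchedPair.
Context {C : braided_category} (D : hopf_data C).
Hypotheses (T : nu_l_trivial D) (N : nu_r_trivial D).
Local Notation TE := eqns[T; N].

Lemma matched_pair_units : is_matched_pair D -> hopf_units D.
Proof.
case=> -[a1 c1 _ e1 u1] [a2 c2 _ e2 u2] [lm _ _ [_ counit_mul]] [rm _ _ [_ counit_mur]].
move=> _ mur_unit _ mul_unit _.
split=> //; rewrite ?T ?N.
- exact: trivial_left_comodule.
- exact: trivial_right_comodule.
- string (pair_signature a1 c1 a2 c2) [] [].
- rewrite counit_mur; string (pair_signature a1 c1 a2 c2) [] [].
- rewrite counit_mul; string (pair_signature a1 c1 a2 c2) [] [].
- string (pair_signature a1 c1 a2 c2) [] [].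
- string (pair_signature a1 c1 a2 c2) [] [].
- string (pair_signature a1 c1 a2 c2) [] [].
Qed.

Lemma hopf_datum_matched_pair : is_hopf_datum D <-> is_matched_pair D.
Proof.
split=> h.
- have U := hopf_datum_units h.
  case: (U) => a1 c1 e1 u1 a2 c2 e2 u2 lm lc rm rc *.
  split=> //.
  + by split=> //; units_from U TE (hd_algebra_coalgebra1 h).
  + by split=> //; units_from U TE (hd_algebra_coalgebra2 h).
  + split=> //; split=> //.
    * exact: comult_hom c1.
    * units_from U TE (hd_module_coalgebra_l h).
    * exact: counit_hom c1.
    * units U TE.
  + split=> //; split=> //.
    * exact: comult_hom c2.
    * units_from U TE (hd_module_coalgebra_r h).
    * exact: counit_hom c2.
    * units U TE.
  + exact: hd_module_algebra_r h.
  + exact: hd_module_algebra_l h.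
  (* With trivial coactions [φ12] is the braiding, and the module-comodule axiom is the last
     condition of a matched pair read backwards. *)
  + units_from U TE (esym (hd_module_comodule h)).
- have U := matched_pair_units h.
  case: (U) => *; split=> //.
  + units_from U TE (bialg_compat (mp_bialgebra1 h)).
  + units_from U TE (bialg_compat (mp_bialgebra2 h)).
  + units_from U TE (esym (mp_compat h)).
  + exact: mp_mur_mult h.
  + exact: mp_mul_mult h.
  + units U TE.
  + units U TE.
  + units_from U TE (proj2 (rmc_comult (mp_rmodule_coalgebra h))).
  + units_from U TE (proj2 (lmc_comult (mp_lmodule_coalgebra h))).
  + units U TE.
  + units U TE.
Qed.
End MatchedPair.

Section Biproduct.
Context {C : braided_category} (D : hopf_data C).
Hypotheses (T : mu_r_trivial D) (N : nu_r_trivial D).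
Local Notation TE := eqns[T; N].

Lemma biproduct_units : is_bialgebra (B2 D) ->
  is_crossed_bialgebra (B2 D) (B1 D) (mu_l D) (nu_l D) -> hopf_units D.
Proof.
case=> a2 c2 _ e2 u2 [[lm lc _] _ [[_ mul_unit] [_ nul_unit]] _
  [[_ counit_mul] [_ nul_counit]] [a1 c1 _ e1 u1]].
split=> //; rewrite ?T ?N.
- exact: trivial_right_module.
- exact: trivial_right_comodule.
- string (pair_signature a1 c1 a2 c2) [] [].
- string (pair_signature a1 c1 a2 c2) [] [].
- rewrite counit_mul; string (pair_signature a1 c1 a2 c2) [] [].
- string (pair_signature a1 c1 a2 c2) [] [].
- string (pair_signature a1 c1 a2 c2) [] [].
- rewrite nul_unit; string (pair_signature a1 c1 a2 c2) [] [].
Qed.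

(** The composite of [νl], [Ψ11] and [μl] inside [hd_algebra_coalgebra1] is the braiding of crossed
    modules. The other left axioms say that [m1] and [Δ1] are morphisms of crossed modules, the
    module-comodule axiom is the crossed condition, and the right axioms become unit identities. *)
Lemma hopf_datum_biproduct : is_hopf_datum D <->
  is_bialgebra (B2 D) /\ is_crossed_bialgebra (B2 D) (B1 D) (mu_l D) (nu_l D).
Proof.
split=> [h|[h2 h1]].
- have U := hopf_datum_units h.
  case: (U) => a1 c1 e1 u1 a2 c2 e2 u2 lm lc rm rc *.
  split; first by split=> //; units_from U TE (hd_algebra_coalgebra2 h).
  split.
  + split=> //; units_from U TE (esym (hd_module_comodule h)).
  + split; split.
    * exact: mult_hom a1.
    * units_from U TE (esym (hd_module_algebra_l h)).
    * exact: mult_hom a1.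
    * units_from U TE (hd_comodule_algebra_l h).
  + split; split=> //; try exact: unit_hom a1.
    units U TE.
  + split; split.
    * exact: comult_hom c1.
    * units_from U TE (hd_module_coalgebra_l h).
    * exact: comult_hom c1.
    * units_from U TE (esym (hd_comodule_coalgebra_l h)).
  + split; split=> //; try exact: counit_hom c1.
    units U TE.
  + split=> //.
    units_from U TE (hd_algebra_coalgebra1 h).
- have U := biproduct_units h2 h1.
  case: (h1) => -[_ _ crossed] [[_ mul_m] [_ nul_m]] _ [[_ Δ_mul] [_ Δ_nul]] _ bialg.
  case: (U) => *; split=> //.
  + units_from U TE (bialg_compat bialg).
  + units_from U TE (bialg_compat h2).
  + units_from U TE (esym crossed).
  + units U TE.
  + units_from U TE (esym mul_m).
  + units U TE.
  + units_from U TE (esym Δ_nul).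
  + units U TE.
  + units_from U TE Δ_mul.
  + units U TE.
  + units_from U TE nul_m.
Qed.
End Biproduct.

Section TensorProduct.
Context {C : braided_category} (D : hopf_data C).
Hypotheses (Tμl : mu_l_trivial D) (Tμr : mu_r_trivial D).
Hypotheses (Tνl : nu_l_trivial D) (Tνr : nu_r_trivial D).
Local Notation TE := eqns[Tμl; Tμr; Tνl; Tνr].

Lemma tensor_product_units :
  is_bialgebra (B1 D) -> is_bialgebra (B2 D) -> hopf_units D.
Proof.
case=> a1 c1 _ e1 u1 [a2 c2 _ e2 u2].
split=> //; rewrite ?Tμl ?Tμr ?Tνl ?Tνr;
  try by string (pair_signature a1 c1 a2 c2) [] [].
- exact: trivial_left_module.
- exact: trivial_left_comodule.
- exact: trivial_right_module.
- exact: trivial_right_comodule.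
Qed.

(** A one-sided inverse of an isomorphism is its inverse. The module-comodule axiom yields the
    identity on [B2 ⊗ B1], while the description asks for it on [B1 ⊗ B2]. *)
Lemma braid_involutive (A B : ob C) :
  Ψ B A ∘ Ψ A B = idm (A ⊗ B)%ob <-> Ψ A B ∘ Ψ B A = idm (B ⊗ A)%ob.
Proof.
suff key (X Y : ob C) : Ψ Y X ∘ Ψ X Y = idm (X ⊗ Y)%ob -> Ψ X Y ∘ Ψ Y X = idm (Y ⊗ X)%ob.
  by split; apply: key.
move=> E; case: (braid_iso X Y) => H [g [Hg [E1 E2]]]; case: (braid_iso Y X) => H' _.
have -> : Ψ Y X = g; last by [].
by rewrite -(comp_idr H') -E2 (compA Hg H H') E (comp_idl Hg).
Qed.

Lemma hopf_datum_tensor_product : is_hopf_datum D <->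
  is_bialgebra (B1 D) /\ is_bialgebra (B2 D) /\
  Ψ (B2 D) (B1 D) ∘ Ψ (B1 D) (B2 D) = idm (B1 D ⊗ B2 D)%ob.
Proof.
rewrite braid_involutive; split=> [h|[h1 [h2 h12]]].
- have U := hopf_datum_units h.
  case: (U) => a1 c1 e1 u1 a2 c2 e2 u2 lm lc rm rc *.
  split; first by split=> //; units_from U TE (hd_algebra_coalgebra1 h).
  split; first by split=> //; units_from U TE (hd_algebra_coalgebra2 h).
  units_from U TE (hd_module_comodule h).
- have U := tensor_product_units h1 h2.
  case: (U) => *; split=> //; try by units U TE.
  + units_from U TE (bialg_compat h1).
  + units_from U TE (bialg_compat h2).
  + units_from U TE h12.
Qed.
End TensorProduct.

(** * The bialgebra of a Hopf datum *)

(** Both sides are products of four factors in [Q]; they differ by exchanging the middle two, which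
    is the last hypothesis. *)
Lemma multiplicative_on_product {C : braided_category} (A1 A2 Q : ob C)
    (m1 m2 mQ φ f1 f2 F : mor C) :
  hom (A1 ⊗ A1)%ob A1 m1 -> hom (A2 ⊗ A2)%ob A2 m2 -> hom (Q ⊗ Q)%ob Q mQ ->
  hom (A2 ⊗ A1)%ob (A1 ⊗ A2)%ob φ -> hom A1 Q f1 -> hom A2 Q f2 ->
  mQ ∘ (mQ ⊗ idm Q) = mQ ∘ (idm Q ⊗ mQ) ->
  F = mQ ∘ (f1 ⊗ f2) -> f1 ∘ m1 = mQ ∘ (f1 ⊗ f1) -> f2 ∘ m2 = mQ ∘ (f2 ⊗ f2) ->
  mQ ∘ (f1 ⊗ f2) ∘ φ = mQ ∘ (f2 ⊗ f1) ->
  F ∘ ((m1 ⊗ m2) ∘ (idm A1 ⊗ φ ⊗ idm A2)) = mQ ∘ (F ⊗ F).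
Proof.
move=> t1 t2 tQ tφ tf1 tf2 assoc -> E1 E2 E21.
have S : well_typed [A1; A2; Q]
    [(OTens (OWire 0) (OWire 0), OWire 0, m1); (OTens (OWire 1) (OWire 1), OWire 1, m2);
     (OTens (OWire 2) (OWire 2), OWire 2, mQ);
     (OTens (OWire 1) (OWire 0), OTens (OWire 0) (OWire 1), φ);
     (OWire 0, OWire 2, f1); (OWire 1, OWire 2, f2)].
  by repeat (apply: Forall_cons; first done).
(* Normal forms bracket products to the right, so the pair to be exchanged is always followed by a
   further factor; [E] is [E21] with that factor attached. *)
have E : mQ ∘ (f1 ⊗ (mQ ∘ (f2 ⊗ idm Q))) ∘ (φ ⊗ idm Q) =
    mQ ∘ (f2 ⊗ (mQ ∘ (f1 ⊗ idm Q))).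
  transitivity (mQ ∘ ((mQ ∘ (f1 ⊗ f2) ∘ φ) ⊗ idm Q)).
    string (Signature S) [] eqns[assoc].
  rewrite E21; string (Signature S) eqns[assoc] [].
string (Signature S) eqns[E1; E2; assoc; E] eqns[assoc].
Qed.

Section TensorSquare.
Context {C : braided_category} (A : bialg_data C).
Hypothesis a : is_algebra A.

Lemma algebra_well_typed : well_typed [A : ob C] [(OTens (OWire 0) (OWire 0), OWire 0, mult A)].
Proof. by apply: Forall_cons => //; apply: mult_hom. Qed.

Let S := Signature algebra_well_typed.
Let mQ := (mult A ⊗ mult A) ∘ (idm A ⊗ Ψ A A ⊗ idm A).

(** Naturality slides each multiplication through the crossing; what remains is associativity in the
    two tensor factors. *)
Lemma tensor_square_assoc :
  mQ ∘ (mQ ⊗ idm (A ⊗ A)%ob) = mQ ∘ (idm (A ⊗ A)%ob ⊗ mQ).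
Proof. rewrite /mQ; string S eqns[mult_assoc a] eqns[mult_assoc a]. Qed.

Lemma hom_tensor_square_mult : hom (A ⊗ A ⊗ (A ⊗ A))%ob (A ⊗ A)%ob mQ.
Proof. rewrite /mQ; string_typed S. Qed.
End TensorSquare.

Section CrossProduct.
Context {C : braided_category}.
Variables (A1 A2 : bialg_data C) (φ21 φ12 : mor C).
Hypotheses (a1 : is_algebra A1) (c1 : is_coalgebra A1).
Hypotheses (a2 : is_algebra A2) (c2 : is_coalgebra A2).
Hypotheses (t21 : hom (A2 ⊗ A1)%ob (A1 ⊗ A2)%ob φ21).
Hypotheses (t12 : hom (A1 ⊗ A2)%ob (A2 ⊗ A1)%ob φ12).

Definition cross_cells : list (oexpr * oexpr * mor C) :=
  let w1 := OWire 0 in let w2 := OWire 1 in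
  (OTens w2 w1, OTens w1 w2, φ21) :: (OTens w1 w2, OTens w2 w1, φ12) ::
  [(OTens w1 w1, w1, mult A1); (OUnit, w1, unit A1);
   (w1, OTens w1 w1, comult A1); (w1, OUnit, counit A1);
   (OTens w2 w2, w2, mult A2); (OUnit, w2, unit A2);
   (w2, OTens w2 w2, comult A2); (w2, OUnit, counit A2)].

Lemma cross_well_typed : well_typed [A1 : ob C; A2 : ob C] cross_cells.
Proof. by do 2 apply: Forall_cons => //; apply: pair_well_typed. Qed.

Let S := Signature cross_well_typed.
Let B := cross_product A1 A2 φ21 φ12.

(** The hypotheses say that [φ21] is a distributive law between the two algebras; [cross_coalgebra]
    is the dual fact. *)
Lemma cross_algebra :
  φ21 ∘ (idm A2 ⊗ mult A1) = (mult A1 ⊗ idm A2) ∘ (idm A1 ⊗ φ21) ∘ (φ21 ⊗ idm A1) ->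
  φ21 ∘ (mult A2 ⊗ idm A1) = (idm A1 ⊗ mult A2) ∘ (φ21 ⊗ idm A2) ∘ (idm A2 ⊗ φ21) ->
  φ21 ∘ (idm A2 ⊗ unit A1) = unit A1 ⊗ idm A2 ->
  φ21 ∘ (unit A2 ⊗ idm A1) = idm A1 ⊗ unit A2 ->
  is_algebra B.
Proof.
move=> E1 E2 E3 E4; split; rewrite /B.
- string_typed S.
- string_typed S.
- string S eqns[E1; E2; mult_assoc a1; mult_assoc a2]
    eqns[E1; E2; mult_assoc a1; mult_assoc a2].
- string S eqns[E4; mult_unitl a1; mult_unitl a2] [].
- string S eqns[E3; mult_unitr a1; mult_unitr a2] [].
Qed.

Lemma cross_coalgebra :
  (idm A2 ⊗ comult A1) ∘ φ12 = (φ12 ⊗ idm A1) ∘ (idm A1 ⊗ φ12) ∘ (comult A1 ⊗ idm A2) ->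
  (comult A2 ⊗ idm A1) ∘ φ12 = (idm A2 ⊗ φ12) ∘ (φ12 ⊗ idm A2) ∘ (idm A1 ⊗ comult A2) ->
  (idm A2 ⊗ counit A1) ∘ φ12 = counit A1 ⊗ idm A2 ->
  (counit A2 ⊗ idm A1) ∘ φ12 = idm A1 ⊗ counit A2 ->
  is_coalgebra B.
Proof.
move=> E1 E2 E3 E4; split; rewrite /B.
- string_typed S.
- string_typed S.
- string S eqns[E1; E2; comult_coassoc c1; comult_coassoc c2]
    eqns[E1; E2; comult_coassoc c1; comult_coassoc c2].
- string S eqns[E4; comult_counitl c1; comult_counitl c2] [].
- string S eqns[E3; comult_counitr c1; comult_counitr c2] [].
Qed.

End CrossProduct.

(** * The bialgebra when [μl] is trivial *)

Section MuLTrivialBialgebra.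
Context {C : braided_category} (D : hopf_data C).
Hypotheses (T : mu_l_trivial D) (h : is_mu_l_trivial_datum D).
Let U : hopf_units D := mu_l_trivial_datum_units T h.
Let S := hopf_signature U.

Let assoc1 := mult_assoc (hu_algebra1 U).
Let assoc2 := mult_assoc (hu_algebra2 U).
Let coassoc1 := comult_coassoc (hu_coalgebra1 U).
Let Δm1 := bialg_compat (lt_bialgebra1 h).
Let Δm2 := lt_algebra_coalgebra2 h.
Let μr_m1 := rmod_assoc (hu_rmodule U).
Let μr_m2 := esym (proj2 (rma_mult (lt_module_algebra2 h))).
Let νr_m2 := proj2 (rca_mult (lt_comodule_algebra2 h)).
Let Δ1_νr := rcomod_coassoc (hu_rcomodule U).
Let Δ2_νl := lcomod_coassoc (hu_lcomodule U).
Let Δ2_νr := lt_comult_nur h.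
Let Δ1_νl := lt_comult_nul h.
Let Δ2_μr := lt_comult_mur h.
Let νl_m1 := lt_nul_mult h.

Notation id1 := (idm (B1 D)).
Notation id2 := (idm (B2 D)).
Notation m1 := (mult (B1 D)).
Notation m2 := (mult (B2 D)).
Notation Δ1 := (comult (B1 D)).
Notation Δ2 := (comult (B2 D)).
Notation φ21 := (smash_phi21 D).
Notation φ12 := (phi12 D).

(** In elements [φ21] sends [b ⊗ a] to [a_(1) ⊗ b·a_(2)], up to braiding: [Δ1] is multiplicative and
    [μr] is an action. *)
Lemma smash_mult1 : φ21 ∘ (id2 ⊗ m1) = (m1 ⊗ id2) ∘ (id1 ⊗ φ21) ∘ (φ21 ⊗ id1).
Proof. string S eqns[Δm1; μr_m1] []. Qed.

Lemma smash_mult2 : φ21 ∘ (m2 ⊗ id1) = (id1 ⊗ m2) ∘ (φ21 ⊗ id2) ∘ (id2 ⊗ φ21).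
Proof. string S eqns[μr_m2; coassoc1] eqns[coassoc1]. Qed.

Lemma comult_phi1 : (id2 ⊗ Δ1) ∘ φ12 = (φ12 ⊗ id1) ∘ (id1 ⊗ φ12) ∘ (Δ1 ⊗ id2).
Proof. string S eqns[Δm1; Δ1_νr; Δ1_νl; assoc1; assoc2] eqns[νr_m2; assoc1; assoc2]. Qed.

Lemma comult_phi2 : (Δ2 ⊗ id1) ∘ φ12 = (id2 ⊗ φ12) ∘ (φ12 ⊗ id2) ∘ (id1 ⊗ Δ2).
Proof.
(* On the right [νl_m1] leaves [Δ1] applied after [νr]; hence iterated coactions are contracted
   here, whereas [comult_phi1] expands them. *)
string S eqns[Δm2; Δ2_νr; esym Δ1_νr; Δ2_νl; assoc1; assoc2] eqns[νl_m1; assoc1; assoc2].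
Qed.

Let B := cross_product (B1 D) (B2 D) φ21 φ12.
Let mQ := (mult B ⊗ mult B) ∘ (idm B ⊗ Ψ B B ⊗ idm B).
Let f1 := comult B ∘ (id1 ⊗ unit (B2 D)).
Let f2 := comult B ∘ (unit (B1 D) ⊗ id2).

(** The inserted units trivialise both copies of [φ21], and the crossing left over in [mQ] is the
    one inside [φ12]. *)
Lemma comult_12 : comult B = mQ ∘ (f1 ⊗ f2).
Proof. rewrite /mQ /f1 /f2 /B; string S [] (unit_equations U). Qed.

Lemma comult_11 : f1 ∘ m1 = mQ ∘ (f1 ⊗ f1).
Proof.
rewrite /mQ /f1 /B.
string S (eqns[Δm1; νl_m1] ++ unit_equations U) (eqns[coassoc1; assoc2] ++ unit_equations U).
Qed.

Lemma comult_22 : f2 ∘ m2 = mQ ∘ (f2 ⊗ f2).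
Proof.
rewrite /mQ /f2 /B.
string S (eqns[Δm2; νr_m2] ++ unit_equations U) (eqns[Δ1_νr; assoc2] ++ unit_equations U).
Qed.

(* [h1 ⊗ κ(a1 ⊗ h2) (ν_r h3) ⊗ a2 h4] with [h3 ⊗ h4] the coaction on the third leg of [h].
   The composite in [lt_compat] is not visible in the normal form of either side of
   [comult_21], since naturality separates its cells. *)
Let mid (κ : mor C) :=
  (id1 ⊗ ((m2 ⊗ m1) ∘ (id2 ⊗ Ψ (B1 D) (B2 D) ⊗ id1) ∘ (κ ⊗ nu_r D)) ⊗ mu_r D)
  ∘ (id1 ⊗ id2 ⊗ Ψ (B2 D) (B1 D ⊗ B2 D)%ob ⊗ id1)
  ∘ (Ψ (B2 D ⊗ B2 D)%ob (B1 D) ⊗ id1 ⊗ nu_l D)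
  ∘ (Δ2 ⊗ ((id1 ⊗ Δ1) ∘ Δ1)).

Lemma comult_21 : mQ ∘ (f1 ⊗ f2) ∘ φ21 = mQ ∘ (f2 ⊗ f1).
Proof.
(* The left side is now [Δ_B φ21]. Each side is compared with [mid] at a different [κ], and the two
   values of [κ] are the two sides of [lt_compat]. *)
rewrite -comult_12; transitivity (mid (φ12 ∘ φ21)); rewrite /mid.
  rewrite /B.
  string S (eqns[coassoc1; Δ2_μr; νr_m2; assoc2; assoc1] ++ unit_equations U)
    eqns[coassoc1; assoc1; assoc2].
(* The compatibility is applied to the term itself, where the composite is still visible, and not
   during normalisation. *)
have -> : φ12 ∘ φ21 = (m2 ⊗ m1) ∘ (mu_r D ⊗ Ψ (B1 D) (B2 D) ⊗ id1)
    ∘ (id2 ⊗ Ψ (B1 D) (B1 D) ⊗ nu_l D) ∘ (nu_r D ⊗ Δ1).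
  by rewrite -(lt_compat h); string S [] [].
rewrite /mQ /f1 /f2 /B.
string S eqns[coassoc1; assoc1; assoc2]
  (eqns[coassoc1; Δ1_νl; assoc2; assoc1] ++ unit_equations U).
Qed.

Lemma smash_bialgebra : is_bialgebra B.
Proof.
have [a1 c1 _ _ a2 c2 _ _ _ _ _ _ _ _ _ _ _ _ _ _] := U.
have t21 : hom (B2 D ⊗ B1 D)%ob (B1 D ⊗ B2 D)%ob φ21 by string_typed S.
have t12 : hom (B1 D ⊗ B2 D)%ob (B2 D ⊗ B1 D)%ob φ12 by string_typed S.
have aB : is_algebra B.
  apply: (cross_algebra a1 c1 a2 c2 t21 t12) smash_mult1 smash_mult2 _ _.
    string S (unit_equations U) [].
  string S (unit_equations U) [].
split=> //.
- apply: (cross_coalgebra a1 c1 a2 c2 t21 t12) comult_phi1 comult_phi2 _ _.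
    string S (unit_equations U) [].
  string S (unit_equations U) [].
- apply: (multiplicative_on_product (mult_hom a1) (mult_hom a2) (hom_tensor_square_mult aB)
    t21 _ _ (tensor_square_assoc aB) comult_12 comult_11 comult_22 comult_21).
    rewrite /f1 /B; string_typed S.
  rewrite /f2 /B; string_typed S.
- split; rewrite /B; string S (unit_equations U) (unit_equations U).
- split; rewrite /B; string S (unit_equations U) (unit_equations U).
Qed.

End MuLTrivialBialgebra.

(** * Opposite and mirror categories *)

(** Once unfolded, a goal in the opposite or mirror category is an equation in the original one that
    agrees with [H] up to bracketing, interchange and naturality, so no rules are supplied. *)
Ltac dual_of H S :=
  refine (etrans _ (etrans H _)); unfold phi12, phi21; cbn; [string S [] [] | string S [] []].

Section Opposite.
Variable C : braided_category.

Definition op_quiver : quiver := {| ob := ob C; mor := mor C; dom := @cod C; cod := @dom C |}.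

Lemma hom_op (A B : ob C) (f : mor C) : @hom op_quiver A B f <-> hom B A f.
Proof. by rewrite /hom /=; split; case. Qed.

Definition op_category : category.
Proof.
refine (@Category op_quiver (@idm C) (fun g f => comp f g) _ _ _ _ _).
- by move=> A; apply/hom_op; apply: hom_idm.
- by move=> A B D f g /hom_op Hf /hom_op Hg; apply/hom_op; apply: hom_comp Hg Hf.
- by move=> A B f /hom_op Hf; apply: comp_idr Hf.
- by move=> A B f /hom_op Hf; apply: comp_idl Hf.
- by move=> A B D E f g k /hom_op Hf /hom_op Hg /hom_op Hk; rewrite (compA Hk Hg Hf).
Defined.

Definition op_monoidal : strict_monoidal_category.
Proof.
refine (@StrictMonoidalCategory op_category (unit_ob C) (@tens_ob C) (@tens C)
  (@tens_obA C) (@tens_ob1l C) (@tens_ob1r C) _ (@tens_idm C) _ (@tensA C) (@tens_1l C) (@tens_1r C)).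
- move=> A B A' B' f f' /hom_op Hf /hom_op Hf'; apply/hom_op; exact: hom_tens Hf Hf'.
- move=> A B D A' B' D' f g f' g' /hom_op Hf /hom_op Hg /hom_op Hf' /hom_op Hg'.
  exact: tens_comp Hg Hf Hg' Hf'.
Defined.

(** A map from [A ⊗ B] to [B ⊗ A] in the opposite category is one from [B ⊗ A] to [A ⊗ B] in [C],
    hence [Ψ B A]; the two hexagons trade places. *)
Definition op_braided : braided_category.
Proof.
refine (@BraidedCategory op_monoidal (fun A B => Ψ B A) _ _ _ _).
- move=> A B; case: (braid_iso B A) => H [g [Hg [E1 E2]]].
  by split; [apply/hom_op | exists g; split; [apply/hom_op | split]].
- move=> A B A' B' f f' /hom_op Hf /hom_op Hf'.
  by rewrite /= (braid_natural Hf' Hf).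
- by move=> A B E; apply: braid_tensr.
- by move=> A B E; apply: braid_tensl.
Defined.

Definition op_bialg (A : bialg_data C) : bialg_data op_braided :=
  @BialgData op_braided A (comult A) (counit A) (mult A) (unit A).

Definition op_hopf (D : hopf_data C) : hopf_data op_braided :=
  @HopfData op_braided (op_bialg (B1 D)) (op_bialg (B2 D)) (nu_l D) (mu_l D) (nu_r D) (mu_r D).

Lemma op_algebra A : is_coalgebra A <-> is_algebra (op_bialg A).
Proof.
split.
- by case=> /hom_op ? /hom_op ? *; split.
- by case=> /hom_op ? /hom_op ? *; split.
Qed.

Lemma op_coalgebra A : is_algebra A <-> is_coalgebra (op_bialg A).
Proof.
split.
- by case=> /hom_op ? /hom_op ? *; split.
- by case=> /hom_op ? /hom_op ? *; split.
Qed.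

(** The algebra-coalgebra and module-comodule axioms are self-dual; duality exchanges module-algebra
    with comodule-coalgebra and module-coalgebra with comodule-algebra. *)
Lemma op_hopf_datum D : is_hopf_datum D -> is_hopf_datum (op_hopf D).
Proof.
move=> h; have U := hopf_datum_units h; set S := hopf_signature U.
have [a1 c1 [e1 e1'] [u1 u1'] a2 c2 [e2 e2'] [u2 u2'] lm lc rm rc] := U.
move=> mur_unit nul_counit counit_mur counit_mul mul_unit nur_counit nur_unit nul_unit.
case: lm => /hom_op ? ? ?; case: lc => /hom_op ? ? ?.
case: rm => /hom_op ? ? ?; case: rc => /hom_op ? ? ?.
split=> //; try by [exact/op_algebra | exact/op_coalgebra | split].
- dual_of (hd_algebra_coalgebra1 h) S.
- dual_of (hd_algebra_coalgebra2 h) S.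
- dual_of (hd_module_comodule h) S.
- dual_of (hd_comodule_coalgebra_r h) S.
- dual_of (hd_comodule_coalgebra_l h) S.
- dual_of (hd_module_algebra_r h) S.
- dual_of (hd_module_algebra_l h) S.
- dual_of (hd_comodule_algebra_r h) S.
- dual_of (hd_comodule_algebra_l h) S.
- dual_of (hd_module_coalgebra_r h) S.
- dual_of (hd_module_coalgebra_l h) S.
Qed.

Lemma op_bialgebra A : is_bialgebra (op_bialg A) -> is_bialgebra A.
Proof.
case=> /op_algebra c /op_coalgebra a compat [counit1 counit2] [unit1 _].
(* The signature for two algebras is used with the same one twice; reification always picks the
   first copy. *)
split=> //; dual_of compat (pair_signature a c a c).
Qed.

End Opposite.

Section Mirror.
Variable C : braided_category.

Definition mirror_monoidal : strict_monoidal_category.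
Proof.
refine (@StrictMonoidalCategory C (unit_ob C) (fun A B => (B ⊗ A)%ob) (fun f g => g ⊗ f)
  _ (@tens_ob1r C) (@tens_ob1l C) _ _ _ _ (@tens_1r C) (@tens_1l C)).
- by move=> A B D; rewrite tens_obA.
- by move=> A B A' B' f f' Hf Hf'; apply: hom_tens.
- by move=> A B; apply: tens_idm.
- by move=> A B D A' B' D' f g f' g' Hf Hg Hf' Hg'; apply: tens_comp Hf' Hg' Hf Hg.
- by move=> f g k; rewrite tensA.
Defined.

Definition mirror_braided : braided_category.
Proof.
refine (@BraidedCategory mirror_monoidal (fun A B => Ψ B A) _ _ _ _).
- by move=> A B; apply: braid_iso.
- by move=> A B A' B' f f' Hf Hf'; apply: braid_natural.
- by move=> A B E; apply: braid_tensr.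
- by move=> A B E; apply: braid_tensl.
Defined.

Definition mirror_bialg (A : bialg_data C) : bialg_data mirror_braided :=
  @BialgData mirror_braided A (mult A) (unit A) (comult A) (counit A).

Definition mirror_hopf (D : hopf_data C) : hopf_data mirror_braided :=
  @HopfData mirror_braided (mirror_bialg (B2 D)) (mirror_bialg (B1 D))
    (mu_r D) (nu_r D) (mu_l D) (nu_l D).

Lemma mirror_algebra A : is_algebra A <-> is_algebra (mirror_bialg A).
Proof. by split; case=> *; split. Qed.

Lemma mirror_coalgebra A : is_coalgebra A <-> is_coalgebra (mirror_bialg A).
Proof. by split; case=> *; split. Qed.

Lemma mirror_hopf_datum D : is_hopf_datum D -> is_hopf_datum (mirror_hopf D).
Proof.
move=> h; have U := hopf_datum_units h; set S := hopf_signature U.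
have [a1 c1 e1 u1 a2 c2 e2 u2 lm lc rm rc] := U.
move=> mur_unit nul_counit counit_mur counit_mul mul_unit nur_counit nur_unit nul_unit.
case: lm => ? ? ?; case: lc => ? ? ?; case: rm => ? ? ?; case: rc => ? ? ?.
split=> //; try by [exact/mirror_algebra | exact/mirror_coalgebra | split].
- dual_of (hd_algebra_coalgebra2 h) S.
- dual_of (hd_algebra_coalgebra1 h) S.
- dual_of (hd_module_comodule h) S.
- dual_of (hd_module_algebra_l h) S.
- dual_of (hd_module_algebra_r h) S.
- dual_of (hd_comodule_coalgebra_l h) S.
- dual_of (hd_comodule_coalgebra_r h) S.
- dual_of (hd_module_coalgebra_l h) S.
- dual_of (hd_module_coalgebra_r h) S.
- dual_of (hd_comodule_algebra_l h) S.
- dual_of (hd_comodule_algebra_r h) S.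
Qed.

Lemma mirror_bialgebra A : is_bialgebra (mirror_bialg A) -> is_bialgebra A.
Proof.
case=> /mirror_algebra a /mirror_coalgebra c compat counit unit.
split=> //; dual_of compat (pair_signature a c a c).
Qed.

End Mirror.

(** * Trivalent Hopf data *)

Section TrivalentBialgebra.
Context {C : braided_category} (D : hopf_data C).
Hypothesis h : is_hopf_datum D.
Let U : hopf_units D := hopf_datum_units h.

Lemma mu_l_trivial_phi21 : mu_l_trivial D -> phi21 D = smash_phi21 D.
Proof. by move=> T; units U eqns[T]. Qed.

Lemma mu_r_trivial_phi21 : mu_r_trivial D -> phi21 D = biproduct_phi21 D.
Proof. by move=> T; units U eqns[T]. Qed.

Lemma nu_r_trivial_phi12 : nu_r_trivial D -> phi12 D = biproduct_phi12 D.
Proof. by move=> T; units U eqns[T]. Qed.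

Lemma mu_trivial_phi21 : mu_l_trivial D -> mu_r_trivial D -> phi21 D = Ψ (B2 D) (B1 D).
Proof. by move=> T T'; units U eqns[T; T']. Qed.

Lemma nu_trivial_phi12 : nu_l_trivial D -> nu_r_trivial D -> phi12 D = Ψ (B1 D) (B2 D).
Proof. by move=> T T'; units U eqns[T; T']. Qed.

End TrivalentBialgebra.

Lemma mu_l_trivial_bialgebra (C : braided_category) (D : hopf_data C) :
  is_hopf_datum D -> mu_l_trivial D -> is_bialgebra (hopf_bialgebra D).
Proof.
move=> h T; rewrite /hopf_bialgebra (mu_l_trivial_phi21 h T).
exact: smash_bialgebra (T) (proj1 (hopf_datum_mu_l_trivial T) h).
Qed.

Lemma nu_l_trivial_bialgebra (C : braided_category) (D : hopf_data C) :
  is_hopf_datum D -> nu_l_trivial D -> is_bialgebra (hopf_bialgebra D).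
Proof.
move=> h T; apply: op_bialgebra.
(* [T] is accepted by conversion: the counit of the opposite [B2] is [η2], so trivial [νl] is
   literally trivial [μl] there. *)
have := mu_l_trivial_bialgebra (D := op_hopf D) (op_hopf_datum h) T.
suff -> : hopf_bialgebra (op_hopf D) = op_bialg (hopf_bialgebra D) by [].
have U := hopf_datum_units h.
rewrite /hopf_bialgebra /cross_product /op_bialg /phi12 /phi21; cbn.
by f_equal; string (hopf_signature U) [] [].
Qed.

Lemma mu_r_trivial_bialgebra (C : braided_category) (D : hopf_data C) :
  is_hopf_datum D -> mu_r_trivial D -> is_bialgebra (hopf_bialgebra D).
Proof.
move=> h T; apply: mirror_bialgebra.
have := mu_l_trivial_bialgebra (D := mirror_hopf D) (mirror_hopf_datum h) T.
suff -> : hopf_bialgebra (mirror_hopf D) = mirror_bialg (hopf_bialgebra D) by [].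
(* Reversing tensor products changes just the bracketing of the three-fold ones, so [tensA]
   suffices. *)
by rewrite /hopf_bialgebra /cross_product /mirror_bialg /phi12 /phi21; cbn; rewrite !tensA.
Qed.

Theorem corollary2p17 (C : braided_category) (hC : idempotents_split C)
    (D : hopf_data C) :
  (* all (co)actions trivial *)
  (mu_l_trivial D -> mu_r_trivial D -> nu_l_trivial D -> nu_r_trivial D ->
    (is_hopf_datum D <->
      is_bialgebra (B1 D) /\ is_bialgebra (B2 D) /\
      Ψ (B2 D) (B1 D) ∘ Ψ (B1 D) (B2 D) = idm (B1 D ⊗ B2 D)%ob) /\
    (is_hopf_datum D ->
      is_bialgebra (hopf_bialgebra D) /\
      hopf_bialgebra D = tensor_product (B1 D) (B2 D))) /\
  (* biproduct *)
  (mu_r_trivial D -> nu_r_trivial D ->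
    (is_hopf_datum D <->
      is_bialgebra (B2 D) /\
      is_crossed_bialgebra (B2 D) (B1 D) (mu_l D) (nu_l D)) /\
    (is_hopf_datum D ->
      is_bialgebra (hopf_bialgebra D) /\
      hopf_bialgebra D =
        cross_product (B1 D) (B2 D) (biproduct_phi21 D) (biproduct_phi12 D))) /\
  (* double cross product *)
  (nu_l_trivial D -> nu_r_trivial D ->
    (is_hopf_datum D <-> is_matched_pair D) /\
    (is_hopf_datum D ->
      is_bialgebra (hopf_bialgebra D) /\
      hopf_bialgebra D =
        cross_product (B1 D) (B2 D) (phi21 D) (Ψ (B1 D) (B2 D)))) /\
  (* bicross product *)
  (mu_l_trivial D -> nu_r_trivial D ->
    (is_hopf_datum D <-> is_bicross_datum D) /\
    (is_hopf_datum D ->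
      is_bialgebra (hopf_bialgebra D) /\
      hopf_bialgebra D =
        cross_product (B1 D) (B2 D) (smash_phi21 D) (biproduct_phi12 D))) /\
  (* trivial mu_l *)
  (mu_l_trivial D ->
    (is_hopf_datum D <-> is_mu_l_trivial_datum D) /\
    (is_hopf_datum D ->
      is_bialgebra (hopf_bialgebra D) /\
      hopf_bialgebra D =
        cross_product (B1 D) (B2 D) (smash_phi21 D) (phi12 D))).
Proof.
split; [|split; [|split; [|split]]].
- move=> Tμl Tμr Tνl Tνr; split; first exact: hopf_datum_tensor_product.
  move=> h; split; first exact: mu_l_trivial_bialgebra.
  by rewrite /hopf_bialgebra mu_trivial_phi21 // nu_trivial_phi12.
- move=> Tμr Tνr; split; first exact: hopf_datum_biproduct.
  move=> h; split; first exact: mu_r_trivial_bialgebra.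
  by rewrite /hopf_bialgebra mu_r_trivial_phi21 // nu_r_trivial_phi12.
- move=> Tνl Tνr; split; first exact: hopf_datum_matched_pair.
  move=> h; split; first exact: nu_l_trivial_bialgebra.
  by rewrite /hopf_bialgebra nu_trivial_phi12.
- move=> Tμl Tνr; split; first exact: hopf_datum_bicross.
  move=> h; split; first exact: mu_l_trivial_bialgebra.
  by rewrite /hopf_bialgebra mu_l_trivial_phi21 // nu_r_trivial_phi12.
- move=> Tμl; split; first exact: hopf_datum_mu_l_trivial.
  move=> h; split; first exact: mu_l_trivial_bialgebra.
  by rewrite /hopf_bialgebra mu_l_trivial_phi21.
Qed.
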